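(* Let $E$ be a real $d\times d$ matrix all of whose eigenvalues have positive real parts, and let $q=\operatorname{trace}(E)$. Let $\beta>0$, let $\varphi:\mathbb{R}^d\to[0,\infty)$ be an $E$-homogeneous, $(\beta,E)$-admissible function, let $0<\alpha\le2$ and $0<H<\beta$, and let $$X_\varphi(x)=\int_{\mathbb{R}^d}\Bigl(\varphi(x-y)^{H-q/\alpha}-\varphi(-y)^{H-q/\alpha}\Bigr)\,Z_\alpha(dy),\qquad x\in\mathbb{R}^d.$$ Then the random field $\{X_\varphi(x)\}_{x\in\mathbb{R}^d}$ has the following properties: (a) operator scaling: for any $c>0$, the fields $\{X_\varphi(c^Ex)\}_{x\in\mathbb{R}^d}$ and $\{c^HX_\varphi(x)\}_{x\in\mathbb{R}^d}$ have the same finite-dimensional distributions; (b) stationary increments: for any $h\in\mathbb{R}^d$, the fields $\{X_\varphi(x+h)-X_\varphi(h)\}_{x\in\mathbb{R}^d}$ and $\{X_\varphi(x)\}_{x\in\mathbb{R}^d}$ have the same finite-dimensional distributions.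
   Context: For $c>0$, $c^E=\exp(E\log c)$ (matrix exponential). There is a norm $\|\cdot\|_0$ on $\mathbb{R}^d$ with unit sphere $S_0=\{x:\|x\|_0=1\}$ such that $(r,\theta)\mapsto r^E\theta$ is a homeomorphism from $(0,\infty)\times S_0$ onto $\mathbb{R}^d\setminus\{0\}$ and, for each $x\neq0$, $t\mapsto\|t^Ex\|_0$ is strictly increasing; fix such a norm. Each $x\neq 0$ is uniquely written $x=\tau(x)^El(x)$ with $\tau(x)>0$, $l(x)\in S_0$; set $\tau(0)=0$ ($\tau$ is continuous). A function $\varphi$ on $\mathbb{R}^d$ is $E$-homogeneous if $\varphi(c^Ex)=c\varphi(x)$ for all $c>0$ and $x\ne0$. A continuous function $\varphi:\mathbb{R}^d\to[0,\infty)$ is $(\beta,E)$-admissible if $\varphi(x)>0$ for all $x\ne0$ and for any $0<A<B$ there is a constant $C>0$ such that, for all $A\le\|y\|\le B$ and all $x$ with $\tau(x)\le1$, $|\varphi(x+y)-\varphi(y)|\le C\tau(x)^\beta$. $Z_\alpha(dy)$ is an independently scattered symmetric $\alpha$-stable ($S\alpha S$) random measure on $\mathbb{R}^d$ with Lebesgue control measure. The integral $\int f\,dZ_\alpha$ of a measurable real function $f$ exists if and only if $\int_{\mathbb{R}^d}|f(y)|^\alpha dy<\infty$; it is linear in $f$ and has characteristic function $t\mapsto\exp(-|t|^\alpha\int|f(y)|^\alpha dy)$ (up to a normalizing constant). Under the stated hypotheses the integral defining $X_\varphi(x)$ exists for every $x\in\mathbb{R}^d$. *)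

(* Defs.v *)
From HB Require Import structures.
From mathcomp Require Import all_boot all_order all_algebra complex.
From mathcomp Require Import all_classical all_reals all_analysis.

Set Implicit Arguments.
Unset Strict Implicit.
Unset Printing Implicit Defensive.

Import Order.TTheory GRing.Theory Num.Theory.
Import numFieldNormedType.Exports HBSimple.

Local Open Scope classical_set_scope.
Local Open Scope ring_scope.

(* The sigma-algebra generated by the coordinates, as for tuples. Over the reals
   it is the Borel sigma-algebra (measurable_cVE). *)
Section measurable_cV.
Context {dT : measure_display} {T : sigmaRingType dT} (n : nat).

Let coord (i : 'I_n) (x : 'cV[T]_n) : T := x i ord0.

Let cV_set0 : g_sigma_preimage coord set0.
Proof. exact: sigma_algebra0. Qed.

Let cV_setC A : g_sigma_preimage coord A -> g_sigma_preimage coord (~` A).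
Proof. exact: sigma_algebraC. Qed.

Let cV_bigcup (F : _^nat) : (forall i, g_sigma_preimage coord (F i)) ->
  g_sigma_preimage coord (\bigcup_i (F i)).
Proof. exact: sigma_algebra_bigcup. Qed.

HB.instance Definition _ := @isMeasurable.Build (measure_tuple_display dT)
  'cV[T]_n (g_sigma_preimage coord) cV_set0 cV_setC cV_bigcup.

End measurable_cV.

Lemma measurable_coord (dT : measure_display) (T : sigmaRingType dT) (n : nat)
    (i : 'I_n) : measurable_fun [set: 'cV[T]_n] (fun x : 'cV[T]_n => x i ord0).
Proof.
move=> _ Y mY; rewrite setTI; apply: sub_sigma_algebra => /=.
rewrite -bigcup_seq/=; exists i => /=; first by rewrite mem_index_enum.
by exists Y => //; rewrite setTI.
Qed.

Lemma measurable_fun_cVP (d1 d2 : measure_display) (T1 : measurableType d1)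
    (T2 : measurableType d2) (n : nat) (f : T1 -> 'cV[T2]_n) :
  (forall i, measurable_fun [set: T1] (fun x => f x i ord0)) ->
  measurable_fun [set: T1] f.
Proof.
move=> mf.
have mG : forall A : set 'cV[T2]_n, (\big[setU/set0]_(i < n)
    preimage_set_system setT (fun x : 'cV[T2]_n => x i ord0) measurable) A ->
    measurable (f @^-1` A).
  move=> A; rewrite -bigcup_seq => -[i _ [B mB <-]].
  by rewrite setTI; have := mf i measurableT B mB; rewrite setTI.
move=> _ A; rewrite setTI.
apply: (@smallest_sub _ (sigma_algebra setT) _ [set A | measurable (f @^-1` A)]).
- split=> /=.
  + by rewrite preimage_set0.
  + by move=> B mB; rewrite setTD preimage_setC; exact: measurableC.
  + by move=> F mF; rewrite preimage_bigcup; exact: bigcup_measurable.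
- exact: mG.
Qed.

Section lebesgue_cV.
Context {R : realType}.

Lemma open_measurable_cV (n : nat) (U : set 'cV[R]_n) :
  open U -> measurable U.
Proof.
move=> oU.
pose Box (p : 'cV[rat]_n * 'cV[rat]_n) : set 'cV[R]_n :=
  [set x | forall i, ratr (p.1 i ord0) < x i ord0 < ratr (p.2 i ord0)].
have mBox p : measurable (Box p).
  rewrite (_ : Box p = \bigcap_(i in [set: 'I_n]) ((fun x : 'cV[R]_n => x i ord0)
    @^-1` `]ratr (p.1 i ord0), ratr (p.2 i ord0)[)); last first.
    by apply/seteqP; split => [x /= H i _|x /= H i];
      have := H i; rewrite /= in_itv/=; auto.
  apply: fin_bigcap_measurable => // i _.
  by rewrite -[X in measurable X]setTI; apply: measurable_coord.
rewrite (_ : U = \bigcup_k (if unpickle k is Some p then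
    if `[< Box p `<=` U >] then Box p else set0 else set0)); last first.
  apply/seteqP; split => [x Ux|x [k _]]; last first.
    by case: (unpickle k) => // p; case: ifPn => // /asboolP; apply.
  have /nbhs_ballP[e /= e0 xeU] : nbhs x U by exact: open_nbhs_nbhs.
  have H i : exists q : rat * rat, x i ord0 - e < ratr q.1 < x i ord0 /\
      x i ord0 < ratr q.2 < x i ord0 + e.
    have /rat_in_itvoo[q1 q1P] : x i ord0 - e < x i ord0 by rewrite ltrBlDr ltrDl.
    have /rat_in_itvoo[q2 q2P] : x i ord0 < x i ord0 + e by rewrite ltrDl.
    by exists (q1, q2); move: q1P q2P; rewrite !in_itv.
  have [q qP] := choice H.
  pose p := (\col_i (q i).1, \col_i (q i).2) : 'cV[rat]_n * 'cV[rat]_n.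
  exists (pickle p) => //; rewrite pickleK; case: ifPn => [_|/asboolPn[]].
    by move=> i; rewrite /p !mxE; have [/andP[_ ->] /andP[->]] := qP i.
  move=> y yB; apply: xeU; split => // i j; rewrite ord1 /ball/= ltr_distlC.
  have := yB i; rewrite /p !mxE => /andP[y1 y2].
  have [/andP[q1 _] /andP[_ q2]] := qP i.
  by rewrite (lt_trans q1 y1) (lt_trans y2 q2).
apply: bigcupT_measurable => k; case: (unpickle k) => // p.
by case: ifPn.
Qed.

Lemma measurable_cVE (n : nat) :
  @measurable _ 'cV[R]_n = <<s @open 'cV[R]_n >>.
Proof.
apply/seteqP; split; last first.
  apply: smallest_sub; first exact: sigma_algebra_measurable.
  exact: open_measurable_cV.
apply: smallest_sub; first exact: smallest_sigma_algebra.
move=> A; rewrite -bigcup_seq => -[i _ [B mB <-]].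
have : measurable_fun (setT : set (g_sigma_algebraType (@open 'cV[R]_n)))
    (fun x : 'cV[R]_n => x i ord0).
  apply: (measurability _ (measurable_realfun.RGenOpens.measurableE R)) => //.
  move=> _ [_ [a [b ->] <-]]; rewrite setTI; apply: sub_sigma_algebra => /=.
  by apply: open_comp => [x _|]; [exact: coord_continuous|exact: interval_open].
by move=> /(_ measurableT B mB).
Qed.

Definition cons_cV (n : nat) (p : R * 'cV[R]_n) : 'cV[R]_n.+1 :=
  col_mx p.1%:M p.2.

Lemma cons_cV0 (n : nat) (p : R * 'cV[R]_n) : cons_cV p ord0 ord0 = p.1.
Proof.
have -> : ord0 = lshift n ord0 :> 'I_(1 + n) by apply/val_inj.
by rewrite [LHS]col_mxEu mxE eqxx mulr1n.
Qed.

Lemma cons_cVS (n : nat) (p : R * 'cV[R]_n) (i : 'I_n) :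
  cons_cV p (lift ord0 i) ord0 = p.2 i ord0.
Proof.
have -> : lift ord0 i = rshift 1 i :> 'I_(1 + n) by apply/val_inj.
by rewrite [LHS]col_mxEd.
Qed.

Lemma measurable_cons_cV (n : nat) : measurable_fun setT (@cons_cV n).
Proof.
apply: measurable_fun_cVP => i; case: (unliftP ord0 i) => [j ->|->].
  apply: (eq_measurable_fun (fun p : R * 'cV[R]_n => p.2 j ord0)) => [p _|].
    by rewrite cons_cVS.
  apply: (measurableT_comp (measurable_coord j)); exact: measurable_snd.
apply: (eq_measurable_fun fst) => [p _|]; last exact: measurable_fst.
by rewrite cons_cV0.
Qed.

Definition uncons_cV (n : nat) (x : 'cV[R]_n.+1) : R * 'cV[R]_n :=
  (x ord0 ord0, \col_i x (lift ord0 i) ord0).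

Lemma cons_cVK (n : nat) : cancel (@cons_cV n) (@uncons_cV n).
Proof.
move=> [r x]; rewrite /uncons_cV cons_cV0; congr pair.
by apply/colP => i; rewrite mxE cons_cVS.
Qed.

Lemma uncons_cVK (n : nat) : cancel (@uncons_cV n) (@cons_cV n).
Proof.
move=> x; apply/colP => i; case: (unliftP ord0 i) => [j ->|->].
  by rewrite cons_cVS mxE.
by rewrite cons_cV0.
Qed.

Lemma measurable_uncons_cV (n : nat) : measurable_fun setT (@uncons_cV n).
Proof.
apply: measurable_fun_pair; first exact: measurable_coord.
apply: measurable_fun_cVP => i.
apply: (eq_measurable_fun (fun x : 'cV[R]_n.+1 => x (lift ord0 i) ord0)) =>
  [x _|].
  by rewrite mxE.
exact: measurable_coord.
Qed.

Section lebesgue_cons.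
Variables (n : nat) (m : {sigma_finite_measure set 'cV[R]_n -> \bar R}).

Definition lebesgue_cons : set 'cV[R]_n.+1 -> \bar R :=
  pushforward (@lebesgue_measure R \x m)%E (@cons_cV n).

Let mc : measurable_fun [set: measurableTypeR R * 'cV[R]_n] (@cons_cV n) :=
  @measurable_cons_cV n.

Let mpre A : measurable A -> measurable (@cons_cV n @^-1` A).
Proof. by move=> mA; rewrite -[X in measurable X]setTI; exact: mc. Qed.

Let lebesgue_cons0 : lebesgue_cons set0 = 0%E.
Proof. by rewrite /lebesgue_cons /pushforward preimage_set0 measure0. Qed.

Let lebesgue_cons_ge0 A : (0 <= lebesgue_cons A)%E.
Proof. exact: measure_ge0. Qed.

Let lebesgue_cons_sigma_additive : semi_sigma_additive lebesgue_cons.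
Proof.
move=> F mF tF mUF; rewrite /lebesgue_cons /pushforward preimage_bigcup.
apply: measure_semi_sigma_additive.
- by move=> k; exact: mpre.
- apply/trivIsetP => /= i j _ _ ij; rewrite -preimage_setI.
  by move/trivIsetP : tF => /(_ _ _ _ _ ij) ->//; rewrite preimage_set0.
- by rewrite -preimage_bigcup; exact: mpre.
Qed.

HB.instance Definition _ := isMeasure.Build _ _ _ lebesgue_cons
  lebesgue_cons0 lebesgue_cons_ge0 lebesgue_cons_sigma_additive.

Let lebesgue_cons_sigma_finite : sigma_finite setT lebesgue_cons.
Proof.
have /sigma_finiteP[F [TF ndF Foo]] := sigma_finiteT (@lebesgue_measure R).
have /sigma_finiteP[G [TG ndG Goo]] := sigma_finiteT m.
exists (fun i => @uncons_cV n @^-1` (F i `*` G i)).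
  rewrite -preimage_bigcup; apply/seteqP; split => // x _ /=.
  have [i _ Fi] : (\bigcup_i F i) (uncons_cV x).1 by rewrite -TF.
  have [j _ Gj] : (\bigcup_i G i) (uncons_cV x).2 by rewrite -TG.
  exists (maxn i j) => //; split.
    by move: Fi; exact/subsetPset/ndF/leq_maxl.
  by move: Gj; exact/subsetPset/ndG/leq_maxr.
move=> i; have [mF Fi] := Foo i; have [mG Gi] := Goo i; split.
  rewrite -[X in measurable X]setTI; apply: measurable_uncons_cV => //.
  exact: measurableX.
rewrite /lebesgue_cons /pushforward -comp_preimage.
rewrite (_ : _ \o _ = id); last by apply/funext => p /=; rewrite cons_cVK.
by rewrite preimage_id product_measure1E// lte_mul_pinfty// ge0_fin_numE.
Qed.

HB.instance Definition _ := Measure_isSigmaFinite.Build _ _ _ lebesgue_cons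
  lebesgue_cons_sigma_finite.

End lebesgue_cons.

(* Lebesgue measure on R^(n+1) is the product of Lebesgue measure on R (first
   coordinate) and Lebesgue measure on R^n; R^0 is a point of mass 1. *)
Fixpoint lebesgue_cV (n : nat) : {sigma_finite_measure set 'cV[R]_n -> \bar R} :=
  if n is n'.+1 then lebesgue_cons (lebesgue_cV n')
  else \d_ (0 : 'cV[R]_0).

Lemma lebesgue_cV_box (n : nat) (A : 'I_n -> set R) :
  (forall i, measurable (A i)) ->
  lebesgue_cV n [set x | forall i, A i (x i ord0)] =
  (\prod_(i < n) lebesgue_measure (A i))%E.
Proof.
elim: n A => [|n IH] A mA.
  by rewrite big_ord0 /= diracE mem_set //= => -[].
have mB : measurable [set x : 'cV[R]_n | forall i, A (lift ord0 i) (x i ord0)].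
  rewrite (_ : mkset _ = \bigcap_(i in [set: 'I_n])
    ((fun x : 'cV[R]_n => x i ord0) @^-1` A (lift ord0 i))); last first.
    by apply/seteqP; split => [x /= H i _|x /= H i]; exact: H.
  apply: fin_bigcap_measurable => // i _.
  by rewrite -[X in measurable X]setTI; exact: measurable_coord.
rewrite big_ord_recl -IH; last by move=> i; exact: mA.
rewrite -[RHS]product_measure1E //=; last exact: mA.
rewrite /lebesgue_cons /pushforward; congr (product_measure1 _ _ _).
apply/seteqP; split => [p/= H|p/= [H0 H] i].
  by split=> [|i]; [have := H ord0|have := H (lift ord0 i)];
    rewrite ?cons_cV0 ?cons_cVS.
by case: (unliftP ord0 i) => [j ->|->]; rewrite ?cons_cV0 ?cons_cVS.
Qed.

End lebesgue_cV.

Section matrix_power.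
Context {R : realType} {d : nat}.

Definition expmx (A : 'M[R]_d) : 'M[R]_d :=
  limn (series (fun k => k`!%:R^-1 *: A ^+ k)).

(* c^E, for c > 0 *)
Definition powmx (c : R) (E : 'M[R]_d) : 'M[R]_d := expmx (ln c *: E).

End matrix_power.

Definition homeomorphism_on (T U : topologicalType) (A : set T) (B : set U)
    (f : T -> U) : Prop :=
  [/\ {within A, continuous f}, set_bij A B f &
      exists2 g : U -> T, {within B, continuous g} & {in A, cancel f g}].

Section homogeneous.
Context {R : realType} {d : nat}.
Implicit Types (E : 'M[R]_d) (N phi : 'cV[R]_d -> R) (x y : 'cV[R]_d).

Definition is_norm N : Prop :=
  [/\ forall x y, N (x + y) <= N x + N y,
      forall (a : R) x, N (a *: x) = `|a| * N x &
      forall x, N x = 0 -> x = 0].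

Definition unit_sphere N : set 'cV[R]_d := [set x | N x = 1].

Definition adapted_norm E N : Prop :=
  [/\ is_norm N,
      homeomorphism_on
        [set p : R * 'cV[R]_d | 0 < p.1 /\ unit_sphere N p.2]
        [set x : 'cV[R]_d | x != 0]
        (fun p : R * 'cV[R]_d => powmx p.1 E *m p.2) &
      forall x, x != 0 ->
        {in `]0, +oo[ &, {homo (fun t : R => N (powmx t E *m x)) : s t / s < t}}].

(* the radial part of x in the polar coordinates x = r^E l, N l = 1 *)
Definition tau E N x : R :=
  if x == 0 then 0
  else xget 0 [set r | 0 < r /\
                exists2 l, unit_sphere N l & x = powmx r E *m l].

Definition euclidean_norm x : R := Num.sqrt (\sum_(i < d) x i ord0 ^+ 2).

Definition E_homogeneous E phi : Prop :=
  forall (c : R) x, 0 < c -> x != 0 -> phi (powmx c E *m x) = c * phi x.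

Definition admissible (beta : R) E N phi : Prop :=
  [/\ continuous phi,
      forall x, 0 <= phi x,
      forall x, x != 0 -> 0 < phi x &
      forall A B : R, 0 < A -> A < B -> exists2 C : R, 0 < C &
        forall x y, A <= euclidean_norm y <= B -> tau E N x <= 1 ->
          `|phi (x + y) - phi y| <= C * tau E N x `^ beta].

(* [powR] sends 0 to 0 for a negative exponent. As phi only vanishes at 0, this
   convention matters at most at y = x and y = 0, a Lebesgue-null set. *)
Definition moving_average_kernel (a : R) phi x y : R :=
  phi (x - y) `^ a - phi (- y) `^ a.

End homogeneous.

Section random_fields.
Context {dO : measure_display} {Omega : measurableType dO} {R : realType}.
Variable P : probability Omega R.

Definition charfun (Y : Omega -> R) (t : R) : R[i] :=
  Complex (fine 'E_P[fun w => cos (t * Y w)]) (fine 'E_P[fun w => sin (t * Y w)]).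

Definition mutually_independent (n : nat) (Y : 'I_n -> Omega -> R) : Prop :=
  forall B : 'I_n -> set R, (forall i, measurable (B i)) ->
    P (\bigcap_(i in [set: 'I_n]) Y i @^-1` B i) =
    (\prod_(i < n) P (Y i @^-1` B i))%E.

Definition cvg_in_probability (Y : nat -> Omega -> R) (Y0 : Omega -> R) : Prop :=
  forall e : R, 0 < e -> P [set w | e <= `|Y n w - Y0 w|] @[n --> \oo] --> 0%E.

Definition same_fdd (T : Type) (X Y : T -> Omega -> R) : Prop :=
  forall (n : nat) (t : 'I_n -> T) (B : set (n.-tuple R)), measurable B ->
    P [set w | B [tuple X (t i) w | i < n]] =
    P [set w | B [tuple Y (t i) w | i < n]].

(* Independently scattered symmetric alpha-stable random measure with Lebesgue
   control measure. Only the values of Z at Borel sets of finite Lebesgue measure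
   are meaningful. *)
Definition sas_random_measure (d : nat) (alpha : R)
    (Z : set 'cV[R]_d -> {RV P >-> R}) : Prop :=
  [/\ forall A, measurable A -> (lebesgue_cV d A < +oo)%E ->
        forall t, charfun (Z A) t =
          (expR (- (`|t| `^ alpha * fine (lebesgue_cV d A))))%:C%C,
      forall (n : nat) (A : 'I_n -> set 'cV[R]_d),
        (forall i, measurable (A i)) ->
        (forall i, lebesgue_cV d (A i) < +oo)%E ->
        trivIset setT A ->
        mutually_independent (fun i => Z (A i)) &
      forall A : nat -> set 'cV[R]_d,
        (forall i, measurable (A i)) ->
        (lebesgue_cV d (\bigcup_i A i) < +oo)%E ->
        trivIset setT A ->
        {ae P, forall w,
          series (fun i => Z (A i) w) @ \oo --> Z (\bigcup_i A i) w}].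

Definition simple_stable_integral (d : nat) (Z : set 'cV[R]_d -> {RV P >-> R})
    (g : {sfun 'cV[R]_d >-> R}) (w : Omega) : R :=
  \sum_(r \in range g) r * Z (g @^-1` [set r]) w.

(* Y is (a version of) the stochastic integral of f with respect to Z: f is in
   L^alpha and Y is the limit in probability of the integrals of simple functions
   approximating f in L^alpha. *)
Definition is_stable_integral (d : nat) (alpha : R)
    (Z : set 'cV[R]_d -> {RV P >-> R}) (f : 'cV[R]_d -> R) (Y : Omega -> R) :
    Prop :=
  [/\ measurable_fun setT f,
      (\int[lebesgue_cV d]_y (`|f y| `^ alpha)%:E < +oo)%E &
      exists g : nat -> {sfun 'cV[R]_d >-> R},
        [/\ forall n, (lebesgue_cV d [set y | g n y != 0%R] < +oo)%E,
            (\int[lebesgue_cV d]_y (`|g n y - f y| `^ alpha)%:E)%E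
              @[n --> \oo] --> 0%E &
            cvg_in_probability (fun n => simple_stable_integral Z (g n)) Y]].

End random_fields.

(* Main.v *)
Require Import Defs.
From HB Require Import structures.
From mathcomp Require Import all_boot all_order all_algebra complex.
From mathcomp Require Import all_classical all_reals all_analysis.
From mathcomp Require Import finmap measurable_realfun ring lra.

Set Implicit Arguments.
Unset Strict Implicit.
Unset Printing Implicit Defensive.

Import Order.TTheory GRing.Theory Num.Theory.
Import numFieldNormedType.Exports HBSimple HBNNSimple.

Local Open Scope classical_set_scope.
Local Open Scope ring_scope.

(** Both parts say that two fields of stable integrals have the same law, and
    that law is read off the kernels alone. If the real combination
    [sum_i t_i f_i] of kernels has [I(t) = int |sum_i t_i f_i|^alpha], then the
    vector of the integrals of the [f_i] has characteristic function
    [t |-> exp (- I(t))]; so two fields have the same finite-dimensional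
    distributions as soon as their kernels give the same [I(t)]
    ([stable_integral_same_fdd]). It remains to compare two integrals over
    R^d. For stationarity of the increments,
    [f_{x+h} - f_h] is [f_x] translated by [h], and Lebesgue measure is
    translation invariant. For operator scaling, substitute [y = c^E z]:
    homogeneity of [phi] gives [f_{c^E x}(c^E z) = c^(H - q/alpha) f_x(z)] for
    almost every [z], the Jacobian of [c^E] is [c^q] with [q] the trace of [E],
    and [alpha (H - q/alpha) + q = alpha H].

    Three ingredients carry this.

    - A law on R^n is determined by its characteristic function
      ([fourier_unique]). Call a bounded function a multiplier when multiplying
      by it preserves equality of Fourier transforms. Cosines of linear forms
      are multipliers, and multipliers are closed under sums, products and
      bounded pointwise limits. Polynomials in [sin (s (x_i - a))] converge
      boundedly to the indicator of [sin (s (x_i - a)) < 0], and these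
      converge to the indicator of [x_i < a] when [s] tends to 0. So the sets
      with a multiplier as indicator form a sigma-algebra that contains the
      half-spaces, hence all Borel sets.

    - A stable integral depends linearly on its kernel
      ([stable_integral_linear]), and its characteristic function is the one
      stated above ([stable_integral_mean_cos]). For simple kernels this is
      additivity and independence of the random measure; in general one passes
      to the limit, in probability on one side and in L^alpha on the other.

    - An invertible linear map [M] multiplies Lebesgue measure by [|det M|]
      ([substitution_rule_unit]), and [det (exp A) = exp (tr A)]
      ([det_expmx]). The first is an induction on the dimension: [M] is a
      product of shears and of a block triangular matrix whose corner is the
      Schur complement, and Tonelli handles each factor. The second follows
      from [exp A = lim (1 + A/n)^n] and
      [det (1 + A/n) = 1 + tr A / n + O(1/n^2)]. *)

(** * Means of bounded measurable functions *)
Section bounded_measurable.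
Context {d : measure_display} {T : measurableType d} {R : realType}.
Implicit Types f g : T -> R.

Definition bounded_measurable f :=
  measurable_fun setT f /\ exists K : R, forall x, `|f x| <= K.

Lemma bounded_measurable_cst (r : R) : bounded_measurable (fun=> r).
Proof. by split => //; exists `|r|. Qed.

Lemma bounded_measurable_indic (A : set T) :
  measurable A -> bounded_measurable (\1_A).
Proof.
move=> mA; split; first exact: measurable_indic.
by exists 1 => x; rewrite indicE; case: (_ \in _); rewrite ?normr1 ?normr0.
Qed.

Lemma bounded_measurableD f g : bounded_measurable f -> bounded_measurable g ->
  bounded_measurable (fun x => f x + g x).
Proof.
move=> [mf [K fK]] [mg [L gL]]; split; first exact: measurable_funD.
by exists (K + L) => x; rewrite (le_trans (ler_normD _ _))// lerD.
Qed.

Lemma bounded_measurableM f g : bounded_measurable f -> bounded_measurable g ->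
  bounded_measurable (fun x => f x * g x).
Proof.
move=> [mf [K fK]] [mg [L gL]]; split; first exact: measurable_funM.
by exists (K * L) => x; rewrite normrM ler_pM.
Qed.

Lemma bounded_measurable_lim (h : nat -> T -> R) f (K : R) :
  (forall n, measurable_fun setT (h n)) -> (forall n x, `|h n x| <= K) ->
  (forall x, h ^~ x @ \oo --> f x) -> bounded_measurable f.
Proof.
move=> mh hK hf; split.
  by apply: (measurable_fun_cvg (h := h)) => // x _; exact: hf.
exists K => x.
have : `|h n x| @[n --> \oo] --> `|f x| by apply: cvg_norm; exact: hf.
by move=> hx; apply: (cvgr_to_le hx); exact: nearW.
Qed.

Context (P : probability T R).

Lemma bounded_measurable_integrable f :
  bounded_measurable f -> P.-integrable setT (EFin \o f).
Proof.
move=> [mf [K fK]]; apply: measurable_bounded_integrable => //.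
  by rewrite -ge0_fin_numE// fin_num_measure.
exists K; split; first exact: num_real.
by move=> M KM x _ /=; apply: le_trans (fK x) _; exact: ltW.
Qed.

Lemma meanD f g : bounded_measurable f -> bounded_measurable g ->
  \int[P]_x (f x + g x) = \int[P]_x f x + \int[P]_x g x.
Proof. by move=> bf bg; apply: RintegralD => //;
  exact: bounded_measurable_integrable. Qed.

Lemma meanZ (r : R) f : bounded_measurable f ->
  \int[P]_x (r * f x) = r * \int[P]_x f x.
Proof. by move=> bf; apply: RintegralZl => //;
  exact: bounded_measurable_integrable. Qed.

Lemma mean_indic (A : set T) : measurable A -> \int[P]_x \1_A x = fine (P A).
Proof. by move=> mA; rewrite /Rintegral integral_indic// setIT. Qed.

Lemma mean_cvg (h : nat -> T -> R) f (K : R) :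
  (forall n, measurable_fun setT (h n)) -> (forall n x, `|h n x| <= K) ->
  (forall x, h ^~ x @ \oo --> f x) ->
  (\int[P]_x h n x) @[n --> \oo] --> \int[P]_x f x.
Proof.
move=> mh hK hf.
have [mf [L fL]] := bounded_measurable_lim mh hK hf.
have iK : P.-integrable setT (EFin \o cst K).
  exact: bounded_measurable_integrable (bounded_measurable_cst K).
have hE x : (h n x)%:E @[n --> \oo] --> (f x)%:E.
  by apply: cvg_EFin; [exact: nearW|exact: hf].
have [_ _] := dominated_convergence (mu := P) (D := setT) measurableT
  (f_ := fun n => EFin \o h n) (f := EFin \o f) (g := EFin \o cst K)
  (fun n => (measurable_EFinP setT (h n)).2 (mh n))
  ((measurable_EFinP setT f).2 mf)
  (aeW P (fun x _ => hE x)) iK (aeW P (fun x n _ => hK n x)).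
rewrite -[X in _ --> X]fineK; last first.
  apply: (integrable_fin_num measurableT); apply: bounded_measurable_integrable.
  exact: bounded_measurable_lim hf.
by move/fine_cvg.
Qed.

End bounded_measurable.

(** * A law on R^n is determined by its characteristic function *)
Section step_functions.
Context {R : realType}.

Lemma bernoulli_ineq (x : R) (n : nat) : -1 <= x ->
    1 + n%:R * x <= (1 + x) ^+ n.
Proof.
move=> x1; elim: n => [|n IH]; first by rewrite mul0r addr0 expr0.
rewrite exprS; apply: le_trans (ler_wpM2l _ IH); last by lra.
have : 0 <= n%:R * x ^+ 2 by rewrite mulr_ge0// sqr_ge0.
rewrite -natr1 expr2; nra.
Qed.

(** With [y = sqrt x], write [n x^n = (n y^n) y^n]: the first factor is bounded,
    because [y (2 - y) <= 1] and Bernoulli bounds [(2 - y)^n] from below. *)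
Lemma cvg_natrM_exp (x : R) : 0 <= x < 1 -> n%:R * x ^+ n @[n --> \oo] --> 0.
Proof.
move=> /andP[x0 x1]; pose y := Num.sqrt x.
have y0 : 0 <= y by exact: sqrtr_ge0.
have y1 : y < 1 by rewrite -sqrtr1 ltr_sqrt.
have nyn n : n%:R * y ^+ n <= (1 - y)^-1.
  rewrite -[leRHS]mul1r ler_pdivlMr ?subr_gt0//.
  have yn : 1 + n%:R * (1 - y) <= (1 + (1 - y)) ^+ n by apply: bernoulli_ineq;
      lra.
  have yn0 : 0 <= y ^+ n by rewrite exprn_ge0.
  have : y ^+ n * (1 + (1 - y)) ^+ n <= 1 by rewrite -exprMn exprn_ile1//; nra.
  nra.
have ycvg : (1 - y)^-1 * y ^+ n @[n --> \oo] --> 0.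
  by apply: cvg_geometric; rewrite ger0_norm.
apply: (squeeze_cvgr _ (cvg_cst 0) ycvg).
apply: nearW => n; rewrite mulr_ge0 ?exprn_ge0//=.
rewrite -[in leLHS](sqr_sqrtr x0) -/y exprAC expr2 mulrA.
by rewrite ler_wpM2r ?exprn_ge0.
Qed.

Lemma step_approx_ge0_le1 (u : R) (n k : nat) :
  0 <= u <= 1 -> 0 <= (1 - u ^+ n) ^+ k <= 1.
Proof.
move=> /andP[u0 u1]; have un0 : 0 <= u ^+ n by rewrite exprn_ge0.
have un1 : u ^+ n <= 1 by rewrite exprn_ile1.
by rewrite exprn_ge0 ?exprn_ile1; lra.
Qed.

(** The polynomials behind the elementary proof of the Stone-Weierstrass theorem,
    with the exponent [n 2^n] instead of [2^n]: the extra factor [n] sends the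
    value at the threshold 1/2 to 0 instead of exp (-1), so that the limit is
    exactly an indicator. Below 1/2 Bernoulli gives the bound
    [1 - n (2u)^n]; from 1/2 on, [1 - u^n <= exp (- u^n)] gives [exp (- n)]. *)
Lemma step_approx_cvg (u : R) : 0 <= u <= 1 ->
  (1 - u ^+ n) ^+ (n * 2 ^ n) @[n --> \oo] --> ((u < 2^-1)%R%:R : R).
Proof.
move=> /andP[u0 u1]; have [uh|uh] := ltP u 2^-1.
- have xlim : 1 - n%:R * (2 * u) ^+ n @[n --> \oo] --> (1 : R).
    rewrite -[X in _ --> X]subr0; apply: cvgB; first exact: cvg_cst.
    by apply: cvg_natrM_exp; lra.
  apply: (squeeze_cvgr _ xlim); last exact: cvg_cst.
  apply: nearW => n; have /andP[_ ->] : 0 <= (1 - u ^+ n) ^+ (n * 2 ^ n) <= 1.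
    by apply: step_approx_ge0_le1; rewrite u0.
  rewrite andbT; have un1 : u ^+ n <= 1 by rewrite exprn_ile1.
  apply: le_trans (bernoulli_ineq _ _); last lra.
  by rewrite natrM natrX exprMn; lra.
- have elim : expR (- n%:R) @[n --> \oo] --> (0 : R).
    exact: cvgn_expR.
  apply: (squeeze_cvgr _ (cvg_cst 0) elim).
  apply: nearW => n; have /andP[-> _] : 0 <= (1 - u ^+ n) ^+ (n * 2 ^ n) <= 1.
    by apply: step_approx_ge0_le1; rewrite u0.
  have un1 : u ^+ n <= 1 by rewrite exprn_ile1.
  apply: (@le_trans _ _ (expR (- u ^+ n) ^+ (n * 2 ^ n))).
    by rewrite lerXn2r ?nnegrE ?expR_ge0 ?expR_ge1Dx//; lra.
  rewrite -expRM_natr ler_expR mulNr lerN2 natrM mulrCA ler_peMr// natrX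
    -exprMn.
  by rewrite exprn_ege1//; lra.
Qed.

(** Once [|x| < n + 1], the argument of the sine lies in (-1, 1), where the sine
    has the sign of its argument. *)
Lemma sin_lt0_cvg (x : R) :
  ((sin (n.+1%:R^-1 * x) < 0)%R%:R : R) @[n --> \oo] --> ((x < 0)%R%:R : R).
Proof.
apply: cvg_near_cst.
have sin_lt0 (y : R) : -1 < y < 0 -> sin y < 0.
  move=> y01; rewrite -oppr_gt0 -sinN sin_gt0_pi//; have := @pi_ge2 R; lra.
near=> n.
have nx : `|n.+1%:R^-1 * x| < 1.
  rewrite normrM normfV normr_nat mulrC ltr_pdivrMr// mul1r.
  rewrite (@lt_le_trans _ _ n%:R)// ?ler_nat//; near: n.
  exact: nbhs_infty_gtr.
have nx0 : (n.+1%:R^-1 * x < 0) = (x < 0) by rewrite pmulr_rlt0// invr_gt0.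
move: nx; rewrite -nx0 ltr_norml => /andP[n1 n2].
have [y0|y0|->] := ltgtP (n.+1%:R^-1 * x) 0; last by rewrite sin0 ltxx.
  by rewrite sin_lt0// n1.
by rewrite ltNge ltW// sin_gt0_pi// y0 (lt_le_trans n2)//; have := @pi_ge2 R;
  lra.
Unshelve. all: by end_near.
Qed.

End step_functions.

Section fourier_uniqueness.
Context {R : realType} {n : nat}.
Implicit Types (w m : n.-tuple R -> R) (t : 'I_n -> R).

Definition dotp t (x : n.-tuple R) : R := \sum_(i < n) t i * tnth x i.

Lemma measurable_dotp t : measurable_fun setT (dotp t).
Proof.
apply: measurable_sum => i; apply: measurable_funM => //.
exact: measurable_tnth.
Qed.

Lemma bounded_measurable_cos d (T : measurableType d) (f : T -> R) :
  measurable_fun setT f -> bounded_measurable (fun x => cos (f x)).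
Proof.
move=> mf; split.
  apply: (measurableT_comp _ mf).
  by apply: continuous_measurable_fun; exact: continuous_cos.
by exists 1 => x; rewrite ler_norml cos_geN1 cos_le1.
Qed.

Context (P Q : probability (n.-tuple R) R).
Hypothesis PQ : forall t (b : R),
  \int[P]_x cos (dotp t x + b) = \int[Q]_x cos (dotp t x + b).

(** The two measures with density [w] have the same Fourier transform; the phase
    [b] packs the real and imaginary parts into one equation. *)
Definition fourier_agree w := bounded_measurable w /\
  forall t (b : R), \int[P]_x (w x * cos (dotp t x + b)) =
                    \int[Q]_x (w x * cos (dotp t x + b)).

(** Being a multiplier is preserved by products by its very definition, which is
    not clear for [fourier_agree]: this is why the argument runs on
    multipliers. *)
Definition fourier_multiplier m := bounded_measurable m /\
  forall w, fourier_agree w -> fourier_agree (fun x => m x * w x).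

Lemma bounded_measurable_cos_dotp t b :
  bounded_measurable (fun x => cos (dotp t x + b)).
Proof.
apply: bounded_measurable_cos; apply: measurable_funD => //.
exact: measurable_dotp.
Qed.

Lemma fourier_agree1 : fourier_agree (fun=> 1).
Proof.
split=> [|t b]; first exact: bounded_measurable_cst.
under eq_Rintegral do rewrite mul1r.
by under [RHS]eq_Rintegral do rewrite mul1r.
Qed.

Lemma fourier_multiplier_cst (r : R) : fourier_multiplier (fun=> r).
Proof.
split=> [|w [bw wE]]; first exact: bounded_measurable_cst.
split=> [|t b]; first by apply: bounded_measurableM => //;
  exact: bounded_measurable_cst.
have bwc := bounded_measurableM bw (bounded_measurable_cos_dotp t b).
under eq_Rintegral do rewrite -mulrA.
under [RHS]eq_Rintegral do rewrite -mulrA.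
by rewrite !meanZ// wE.
Qed.

Lemma fourier_multiplierM m m' : fourier_multiplier m ->
    fourier_multiplier m' ->
  fourier_multiplier (fun x => m x * m' x).
Proof.
move=> [bm mE] [bm' m'E]; split=> [|w /m'E/mE];
  first exact: bounded_measurableM.
by under eq_fun do rewrite mulrA.
Qed.

Lemma fourier_multiplierD m m' : fourier_multiplier m ->
    fourier_multiplier m' ->
  fourier_multiplier (fun x => m x + m' x).
Proof.
move=> [bm mE] [bm' m'E]; split=> [|w wE]; first exact: bounded_measurableD.
have [[b1 e1] [b2 e2]] := (mE _ wE, m'E _ wE).
split=> [|t b].
  by under eq_fun do rewrite mulrDl; exact: bounded_measurableD.
under eq_Rintegral do rewrite !mulrDl.
under [RHS]eq_Rintegral do rewrite !mulrDl.
have bc := bounded_measurable_cos_dotp t b.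
by rewrite !meanD ?e1 ?e2//; exact: bounded_measurableM.
Qed.

Lemma fourier_multiplierX m k : fourier_multiplier m ->
  fourier_multiplier (fun x => m x ^+ k).
Proof.
move=> mE; elim: k => [|k IH]; first exact: fourier_multiplier_cst.
by under eq_fun do rewrite exprS; exact: fourier_multiplierM.
Qed.

(** The product of two cosines is a half-sum of cosines of linear forms. *)
Lemma fourier_multiplier_cos t b :
  fourier_multiplier (fun x => cos (dotp t x + b)).
Proof.
have bc := bounded_measurable_cos_dotp t b.
split=> // w [bw wE]; split=> [|s c]; first exact: bounded_measurableM.
have cosM x : cos (dotp t x + b) * w x * cos (dotp s x + c) =
  2^-1 * (w x * cos (dotp (t \+ s) x + (b + c)) +
          w x * cos (dotp (t \- s) x + (b - c))).
  have -> : dotp (t \+ s) x + (b + c) = (dotp t x + b) + (dotp s x + c).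
    rewrite /dotp; under eq_bigr do rewrite mulrDl.
    by rewrite big_split/=; ring.
  have -> : dotp (t \- s) x + (b - c) = (dotp t x + b) - (dotp s x + c).
    rewrite /dotp; under eq_bigr do rewrite mulrBl.
    by rewrite sumrB/=; ring.
  by move: (_ + b) (_ + c) => y z; rewrite cosB cosD; field.
have bwc u a := bounded_measurableM bw (bounded_measurable_cos_dotp u a).
under eq_Rintegral do rewrite cosM.
under [RHS]eq_Rintegral do rewrite cosM.
rewrite !meanZ ?meanD ?wE//; exact: bounded_measurableD.
Qed.

Lemma fourier_multiplier_lim (h : nat -> n.-tuple R -> R) m (K : R) :
  (forall k, fourier_multiplier (h k)) -> (forall k x, `|h k x| <= K) ->
  (forall x, h ^~ x @ \oo --> m x) -> fourier_multiplier m.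
Proof.
move=> hE hK hm.
have mh k : measurable_fun setT (h k) by case: (hE k) => -[].
have bm := bounded_measurable_lim mh hK hm.
split=> // w wE; have [bw _] := wE; split=> [|t b];
  first exact: bounded_measurableM.
have bwc := bounded_measurableM bw (bounded_measurable_cos_dotp t b).
have [mwc [L wcL]] := bwc.
have lim (S : probability (n.-tuple R) R) :
    \int[S]_x (h k x * w x * cos (dotp t x + b)) @[k --> \oo] -->
    \int[S]_x (m x * w x * cos (dotp t x + b)).
  apply: (@mean_cvg _ _ _ S (fun k x => h k x * w x * cos (dotp t x + b)) _
    (K * L)).
  - move=> k; under eq_fun do rewrite -mulrA.
    exact: measurable_funM.
  - by move=> k x; rewrite -mulrA normrM ler_pM.
  - move=> x; apply: cvgMl; apply: cvgMl; exact: hm.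
have := lim P; under eq_fun do rewrite (((hE _).2 _ wE).2 t b).
by move/cvg_unique => /(_ _ _ (lim Q)) <-.
Qed.

Lemma fourier_multiplier_sin (i : 'I_n) (s a : R) :
  fourier_multiplier (fun x => sin (s * (tnth x i - a))).
Proof.
(* the linear form s x_i, with the phase that turns the cosine into a sine *)
have := fourier_multiplier_cos (fun j => s * (j == i)%:R) (- (s * a) - pi / 2).
congr fourier_multiplier; apply/funext => x; rewrite addrA cosBpihalf.
congr sin; rewrite mulrBr; congr (_ - _).
rewrite /dotp (bigD1 i)//= eqxx mulr1 big1 ?addr0// => j /negPf ->.
by rewrite mulr0 mul0r.
Qed.

(** Two limits: polynomials in [(1 + sin (s (x_i - a))) / 2] tend to the indicator
    of a periodic union of strips, and for [s = 1 / (k + 1)] the strip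
    next to [a] grows into the half-space. *)
Lemma fourier_multiplier_lt (i : 'I_n) (a : R) :
  fourier_multiplier (fun x => (tnth x i < a)%R%:R).
Proof.
have sin_half (y : R) : ((1 + sin y) / 2 < 2^-1) = (sin y < 0).
  by apply/idP/idP; lra.
have sin01 (y : R) : 0 <= (1 + sin y) / 2 <= 1.
  by have := sin_geN1 y; have := sin_le1 y; lra.
have halfspace s : fourier_multiplier (fun x =>
    (sin (s * (tnth x i - a)) < 0)%R%:R).
  apply: (@fourier_multiplier_lim
    (fun k x => (1 - ((1 + sin (s * (tnth x i - a)))
      / 2) ^+ k) ^+ (k * 2 ^ k)) _ 1).
  - move=> k; apply: fourier_multiplierX.
    have := fourier_multiplierD (fourier_multiplier_cst 1)
      (fourier_multiplierM (fourier_multiplier_cst (-1)) (fourier_multiplierX k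
        (fourier_multiplierM (fourier_multiplierD (fourier_multiplier_cst 1)
          (fourier_multiplier_sin i s a)) (fourier_multiplier_cst 2^-1)))).
    by under eq_fun do rewrite mulN1r.
  - move=> k x; have /andP[h0 h1] := step_approx_ge0_le1 k (k * 2 ^ k) (sin01
    (s * (tnth x i - a))).
    by rewrite ger0_norm.
  - move=> x; have := step_approx_cvg (sin01 (s * (tnth x i - a))).
    by rewrite sin_half.
apply: (@fourier_multiplier_lim
    (fun k x => (sin (k.+1%:R^-1 * (tnth x i - a)) < 0)%R%:R) _ 1).
- by move=> k; exact: halfspace.
- by move=> k x; case: (_ < _); rewrite ?normr1 ?normr0.
- by move=> x; rewrite -subr_lt0; exact: sin_lt0_cvg.
Qed.

(** Products of indicators give finite intersections, and bounded limits give
    countable ones. *)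
Lemma sigma_algebra_fourier_multiplier :
  sigma_algebra setT [set B : set (n.-tuple R) | fourier_multiplier (\1_B : _
    -> R)].
Proof.
have mC B : fourier_multiplier (\1_B : _ -> R) ->
    fourier_multiplier (\1_(~` B) : _ -> R).
  move=> mB; have := fourier_multiplierD (fourier_multiplier_cst 1)
    (fourier_multiplierM (fourier_multiplier_cst (-1)) mB).
  congr fourier_multiplier; apply/funext => x; rewrite !indicE in_setC mulN1r.
  by case: (x \in B); rewrite ?subrr ?subr0.
split=> /=.
- by rewrite indic0; exact: fourier_multiplier_cst.
- by move=> B mB; rewrite setTD; exact: mC.
move=> F mF.
have mI k : fourier_multiplier (\1_(\bigcap_(j < k) ~` F j) : _ -> R).
  elim: k => [|k IH].
    rewrite bigcap_mkord big_ord0 indicT; exact: fourier_multiplier_cst.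
  rewrite bigcap_mkord big_ord_recr/= -(bigcap_mkord k (fun j =>
    ~` F j)) indicI.
  by apply: fourier_multiplierM => //; exact: mC.
rewrite -[X in \1_X]setCK; apply: mC; rewrite setC_bigcup.
apply: (fourier_multiplier_lim (K := 1) mI).
- by move=> k x; rewrite indicE; case: (_ \in _); rewrite ?normr1 ?normr0.
move=> x; apply: cvg_near_cst.
have [xF|/existsNP[k /not_implyP[_ xF]]] := pselect ((\bigcap_k ~` F k) x).
  apply: nearW => k; rewrite !indicE !mem_set// => j _; exact: xF.
near=> j; rewrite !indicE !memNset//; first by move/(_ k I).
move=> /(_ k); apply/not_implyP; split=> //=; near: j; exact: nbhs_infty_gt.
Unshelve. all: by end_near.
Qed.

(** The sigma-algebra of R^n is generated by the coordinates, and the Borel sets of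
    the line by the rays, so the half-spaces suffice. *)
Lemma fourier_multiplier_indic (B : set (n.-tuple R)) :
  measurable B -> fourier_multiplier (\1_B : _ -> R).
Proof.
have sB := sigma_algebra_fourier_multiplier.
move: B; apply: smallest_sub => // B; rewrite -bigcup_seq => -[i _ [A mA <-]].
rewrite setTI; move: A mA.
have -> : @measurable _ R = (@RGenCInfty.G R).-sigma.-measurable :=
  RGenCInfty.measurableE R.
apply: smallest_sub.
  have [s0 sC sU] := sB; split=> /=.
  - by rewrite preimage_set0.
  - by move=> A mA; rewrite setTD preimage_setC -setTD; exact: sC.
  - by move=> F mF; rewrite preimage_bigcup; exact: sU.
move=> _ [a ->] /=.
have [_ sC _] := sB; rewrite -[_ @^-1` _]setCK -setTD; apply: sC => /=.
have := fourier_multiplier_lt i a; congr fourier_multiplier; apply/funext => x.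
rewrite indicE; congr (nat_of_bool _)%:R.
apply/idP/idP => [xa|/set_mem/=].
  by apply/mem_set => /=; rewrite in_itv/= andbT leNgt xa.
by rewrite in_itv/= andbT => /negP; rewrite -ltNge.
Qed.

(** The indicator of [B] is a multiplier; evaluate at frequency 0. *)
Lemma fourier_unique (B : set (n.-tuple R)) : measurable B -> P B = Q B.
Proof.
move=> mB; have [_ mulB] := fourier_multiplier_indic mB.
have [_ /(_ (fun=> 0) 0)] := mulB _ fourier_agree1.
have E (S : probability (n.-tuple R) R) :
    \int[S]_x (\1_B x * 1 * cos (dotp (fun=> 0) x + 0)) = fine (S B).
  rewrite -mean_indic//; apply: eq_Rintegral => x _.
  by rewrite /dotp big1 ?addr0 ?cos0 ?mulr1// => j _; rewrite mul0r.
rewrite !E => PBQB.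
by rewrite -[LHS]fineK ?fin_num_measure// PBQB fineK ?fin_num_measure.
Qed.

End fourier_uniqueness.

(** * The characteristic function of a sum of independent variables *)
Section bounded_measurable_ind.
Context {d : measure_display} {T : measurableType d} {R : realType}.

(** The functional monotone class theorem, in the form needed to pass from
    indicators to cosines. *)
Lemma bounded_measurable_ind (Q : (T -> R) -> Prop) :
  (forall A, measurable A -> Q (\1_A)) ->
  (forall (a : R) f g, bounded_measurable f -> bounded_measurable g ->
    Q f -> Q g -> Q (fun x => a * f x + g x)) ->
  (forall (h : nat -> T -> R) f (K : R),
    (forall n, bounded_measurable (h n)) -> (forall n x, `|h n x| <= K) ->
    (forall x, h ^~ x @ \oo --> f x) -> (forall n, Q (h n)) -> Q f) ->
  forall f, bounded_measurable f -> Q f.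
Proof.
move=> Q1 Qlin Qlim.
have Q0 : Q (fun=> 0) by have := Q1 _ measurable0; rewrite indic0.
have Qsum (s : seq R) (A : R -> set T) : (forall r, measurable (A r)) ->
    bounded_measurable (fun x => \sum_(r <- s) r * \1_(A r) x) /\
    Q (fun x => \sum_(r <- s) r * \1_(A r) x).
  move=> mA; elim: s => [|r s [bs Qs]].
    under eq_fun do rewrite big_nil.
    by split=> //; exact: bounded_measurable_cst.
  under eq_fun do rewrite big_cons.
  have bA := bounded_measurable_indic (mA r) (R := R).
  split; last by apply: Qlin => //; exact: Q1.
  apply: bounded_measurableD => //; apply: bounded_measurableM => //.
  exact: bounded_measurable_cst.
have Qnn (g : {nnsfun T >-> R}) : bounded_measurable g /\ Q g.
  have -> : (g : T -> R) =
      fun x => \sum_(r <- fset_set (range g)) r * \1_(g @^-1` [set r]) x.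
    by apply/funext => x; rewrite [LHS]fimfunE fsbig_finite.
  by apply: Qsum => r.
have Qge0 f : bounded_measurable f -> (forall x, 0 <= f x) -> Q f.
  move=> [mf [K fK]] f0.
  have mEf : measurable_fun setT (EFin \o f) by exact/measurable_EFinP.
  pose h := nnsfun_approx measurableT mEf.
  have hf x : h ^~ x @ \oo --> f x.
    have /fine_cvg := @cvg_nnsfun_approx _ _ _ _ measurableT _ mEf
      (fun x _ => f0 x) x I.
    exact.
  apply: (Qlim (fun n => h n : T -> R) f K) => //; last first.
  - by move=> n; have [] := Qnn (h n).
  - move=> n x; rewrite ger0_norm//; apply: le_trans (fK x).
    apply: le_trans (ler_norm _).
    have nd : nondecreasing_seq (h ^~ x).
      by move=> a b ab; exact/lefP/nd_nnsfun_approx.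
    rewrite -(cvg_lim _ (hf x))//; apply: nondecreasing_cvgn_le => //.
    by apply/cvg_ex; exists (f x).
  - by move=> n; have [] := Qnn (h n).
move=> f bf; have [mf [K fK]] := bf.
have bK (r : R) := bounded_measurable_cst (T := T) r.
have QK : Q (fun=> K).
  have -> : (fun=> K) = (fun _ : T => K * 1 + 0).
    by apply/funext => x; rewrite mulr1 addr0.
  by apply: Qlin => //; have := Q1 _ measurableT; rewrite indicT.
have -> : f = fun x => (-1) * K + (K + f x).
  by apply/funext => x; rewrite mulN1r addKr.
apply: Qlin => //; first exact: bounded_measurableD.
apply: Qge0.
  exact: bounded_measurableD.
by move=> x; have := fK x; rewrite ler_norml; lra.
Qed.

End bounded_measurable_ind.

Section independence.
Context {d : measure_display} {T : measurableType d} {R : realType}.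
Context (P : probability T R).

Lemma bounded_measurable_comp (F : R -> R) (Y : T -> R) :
  bounded_measurable F -> measurable_fun setT Y ->
  bounded_measurable (fun x => F (Y x)).
Proof.
move=> [mF [K FK]] mY; split; first exact: measurableT_comp.
by exists K.
Qed.

(** [W] behaves as if it had mean [c] and were independent of [Y]. It is enough to
    know this on events, by [bounded_measurable_ind]. *)
Lemma mean_indep_factor (W Y : T -> R) (c : R) :
  bounded_measurable W -> measurable_fun setT Y ->
  (forall B, measurable B ->
    \int[P]_x (\1_B (Y x) * W x) = \int[P]_x \1_B (Y x) * c) ->
  forall F : R -> R, bounded_measurable F ->
    \int[P]_x (F (Y x) * W x) = \int[P]_x F (Y x) * c.
Proof.
move=> bW mY HB; apply: bounded_measurable_ind =>
  [//|a f g bf bg fE gE|h f K bh hK hf hE].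
  have [bfY bgY] := (bounded_measurable_comp bf mY,
      bounded_measurable_comp bg mY).
  under eq_Rintegral do rewrite mulrDl -mulrA.
  have [bfW bgW] := (bounded_measurableM bfY bW, bounded_measurableM bgY bW).
  have ba := bounded_measurable_cst (T := T) a.
  rewrite !meanD ?meanZ//; try exact: bounded_measurableM.
  by rewrite fE gE mulrDl mulrA.
have [mW [L WL]] := bW.
have mhY n : measurable_fun setT (fun x => h n (Y x)).
  by have [] := bounded_measurable_comp (bh n) mY.
have lim1 : \int[P]_x (h n (Y x) * W x) @[n --> \oo] --> \int[P]_x (f (Y x) * W
    x).
  apply: (@mean_cvg _ _ _ P (fun n x => h n (Y x) * W x) _ (K * L)).
  - by move=> n; exact: measurable_funM.
  - by move=> n x; rewrite normrM ler_pM.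
  - by move=> x; apply: cvgMl; exact: hf.
have lim2 : \int[P]_x (h n (Y x)) * c @[n --> \oo] --> \int[P]_x f (Y x) * c.
  apply: cvgMl; apply: (@mean_cvg _ _ _ P (fun n x => h n (Y x)) _ K) => //.
by move: lim1; under eq_fun do rewrite hE; move/cvg_unique => /(_ _ _ lim2) ->.
Qed.

Context (n : nat) (Y : 'I_n -> T -> R).
Hypothesis mY : forall i, measurable_fun setT (Y i).
Hypothesis indY : mutually_independent P Y.

Lemma bounded_measurable_prod (F : 'I_n -> R -> R) (D : {pred 'I_n}) :
  (forall i, bounded_measurable (F i)) ->
  bounded_measurable (fun x => \prod_(i | i \in D) F i (Y i x)).
Proof.
move=> bF; have bFY i := bounded_measurable_comp (bF i) (mY i).
elim: (index_enum _) => [|i s IH].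
  by under eq_fun do rewrite big_nil; exact: bounded_measurable_cst.
under eq_fun do rewrite big_cons.
by case: (i \in D) => //; exact: bounded_measurableM.
Qed.

(** Independence is the case of indicators; the factors are then replaced one at
    a time by arbitrary bounded functions. *)
Lemma mean_prod_indep (F : 'I_n -> R -> R) :
  (forall i, bounded_measurable (F i)) ->
  \int[P]_x \prod_(i < n) F i (Y i x) = \prod_(i < n) \int[P]_x F i (Y i x).
Proof.
(* s lists the factors that are already allowed to be arbitrary *)
suff H (s : seq 'I_n) : forall F : 'I_n -> R -> R,
    (forall i, bounded_measurable (F i)) ->
    (forall i, i \notin s -> exists2 B, measurable B & F i = \1_B) ->
  \int[P]_x \prod_(i < n) F i (Y i x) = \prod_(i < n) \int[P]_x F i (Y i x).
  by move=> bF; apply: (H (enum 'I_n)) => // i; rewrite mem_enum.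
elim: s => [|i s IH] {}F bF Find.
  have H i : exists B, measurable B /\ F i = \1_B.
    by have [B] := Find i erefl; exists B.
  have [B HB] := choice H.
  have mB i : measurable (B i) by case: (HB i).
  have mYB i : measurable (Y i @^-1` B i).
    by rewrite -[X in measurable X]setTI; exact: mY.
  transitivity (fine (P (\bigcap_(i in [set: 'I_n]) Y i @^-1` B i))).
    rewrite -mean_indic; last by apply: fin_bigcap_measurable => // i _;
      exact: mYB.
    apply: eq_Rintegral => x _; rewrite indicE.
    have [xB|xB] := boolP (_ \in _).
      rewrite big1 => // i _; have [_ ->] := HB i; rewrite indicE mem_set//.
      by move/set_mem: xB => /(_ i I).
    have /existsNP[i /not_implyP[_ xBi]] : ~ (\bigcap_(i in [set: 'I_n]) Y i
        @^-1` B i) x.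
      by move=> /mem_set; exact/negP.
    by rewrite (bigD1 i)//= (HB i).2 indicE memNset ?mul0r.
  rewrite indY//; under eq_bigr do rewrite -[P _]fineK ?fin_num_measure//.
  rewrite prodEFin/=.
  apply: eq_bigr => i _; rewrite -mean_indic//.
  by apply: eq_Rintegral => x _; rewrite (HB i).2 !indicE.
pose c := \prod_(j < n | j != i) \int[P]_x F j (Y j x).
pose W x := \prod_(j < n | j != i) F j (Y j x).
have bW : bounded_measurable W by exact: bounded_measurable_prod.
have -> : \int[P]_x \prod_(i < n) F i (Y i x) = \int[P]_x (F i (Y i x) * W x).
  by apply: eq_Rintegral => x _; rewrite (bigD1 i).
rewrite [RHS](bigD1 i)//=; apply: mean_indep_factor => // B mB.
pose G j := if j == i then \1_B else F j.
have GE j : j != i -> G j = F j by rewrite /G => /negPf ->.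
have bG j : bounded_measurable (G j).
  by rewrite /G; case: eqP => // _; exact: bounded_measurable_indic.
have {IH} : \int[P]_x \prod_(j < n) G j (Y j x) =
    \prod_(j < n) \int[P]_x G j (Y j x).
  apply: IH => // j js; have [->|ji] := eqVneq j i.
    by exists B => //; rewrite /G eqxx.
  by rewrite GE//; apply: Find; rewrite inE negb_or ji.
rewrite [in RHS](bigD1 i)//=.
have -> : \prod_(j < n | j != i) \int[P]_x G j (Y j x) = c.
  by apply: eq_bigr => j ji; rewrite GE.
have -> : \int[P]_x \prod_(j < n) G j (Y j x) = \int[P]_x (\1_B (Y i x) * W x).
  apply: eq_Rintegral => x _; rewrite (bigD1 i)//= {1}/G eqxx; congr (_ * _).
  by apply: eq_bigr => j ji; rewrite GE.
by rewrite {1}/G eqxx.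
Qed.

(** The real form of [E exp (i (b + S)) = exp (i b) prod E exp (i c_j Y_j)]. The
    imaginary parts vanish by symmetry, and the free phase [b] lets one
    induction on the cosine also cover the sine. *)
Lemma mean_cos_sum_indep (c : 'I_n -> R) (b : R) :
  (forall i, \int[P]_x sin (c i * Y i x) = 0) ->
  \int[P]_x cos (b + \sum_(i < n) c i * Y i x) =
  cos b * \prod_(i < n) \int[P]_x cos (c i * Y i x).
Proof.
move=> sin0.
have bcos (a r : R) : bounded_measurable (fun y : R => cos (a * y + r)).
  by apply: bounded_measurable_cos; apply: measurable_funD.
have bcos0 (a : R) : bounded_measurable (fun y : R => cos (a * y)).
  by have := bcos a 0; under eq_fun do rewrite addr0.
have bsin (a : R) : bounded_measurable (fun y : R => sin (a * y)).
  by have := bcos a (- (pi / 2)); under eq_fun do rewrite cosBpihalf.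
have bone : bounded_measurable (fun _ : R => 1 : R)
    by exact: bounded_measurable_cst.
have mean1 : \int[P]_x (1 : R) = 1.
  have := mean_indic P measurableT; rewrite indicT => ->.
  by rewrite probability_setT.
(* G carries the factors that the sum over s has not absorbed yet *)
suff H (s : seq 'I_n) : uniq s -> forall (b : R) (G : 'I_n -> R -> R),
    (forall i, bounded_measurable (G i)) -> (forall i, i \in s ->
      G i = fun=> 1) ->
    \int[P]_x (cos (b + \sum_(i <- s) c i * Y i x) * \prod_(i < n) G i (Y i x))
      =
    cos b * \prod_(i <- s) \int[P]_x cos (c i * Y i x) *
    \prod_(i < n) \int[P]_x G i (Y i x).
  have := H _ (index_enum_uniq _) b (fun _ _ => 1) (fun=> bone) (fun _ _ =>
      erefl).
  rewrite [in X in _ = _ * X -> _]big1// mulr1 => <-.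
  by apply: eq_Rintegral => x _; rewrite [X in _ = _ * X]big1// mulr1.
elim: s => [_|i s IH /= /andP[ins us]] {}b G bG G1.
  rewrite big_nil mulr1 -mean_prod_indep// -meanZ;
    last exact: bounded_measurable_prod.
  by apply: eq_Rintegral => x _; rewrite big_nil addr0.
pose G_ (F : R -> R) j := if j == i then F else G j.
have bG_ F : bounded_measurable F -> forall j, bounded_measurable (G_ F j).
  by move=> bF j; rewrite /G_; case: eqP.
have G_1 F j : j \in s -> G_ F j = fun=> 1.
  rewrite /G_; case: eqP => [->|_ js]; first by rewrite (negPf ins).
  by apply: G1; rewrite inE js orbT.
have Gi : G i = fun=> 1 by apply: G1; rewrite inE eqxx.
have G_x F x : \prod_(j < n) G_ F j (Y j x) =
    F (Y i x) * \prod_(j < n) G j (Y j x).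
  rewrite (bigD1 i)//= [in RHS](bigD1 i)//= Gi mul1r {1}/G_ eqxx; congr (_ * _).
  by apply: eq_bigr => j /negPf ji; rewrite /G_ ji.
have G_m F : \prod_(j < n) \int[P]_x G_ F j (Y j x) =
    \int[P]_x F (Y i x) * \prod_(j < n) \int[P]_x G j (Y j x).
  rewrite (bigD1 i)//= [in RHS](bigD1 i)//= Gi mean1 mul1r {1}/G_ eqxx;
    congr (_ * _).
  by apply: eq_bigr => j /negPf ji; rewrite /G_ ji.
have bS (r : R) : bounded_measurable (fun x =>
    cos (r + \sum_(i <- s) c i * Y i x)).
  apply: bounded_measurable_cos; apply: measurable_funD => //.
  by apply: measurable_sum => j; exact: measurable_funM.
have bP (F : R -> R) (r : R) : bounded_measurable F ->
    bounded_measurable (fun x => cos (r + \sum_(i <- s) c i * Y i x) *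
      \prod_(j < n) G_ F j (Y j x)).
  move=> bF; apply: bounded_measurableM => //; apply: bounded_measurable_prod.
  exact: bG_.
transitivity (\int[P]_x (
   cos (b + \sum_(i <- s) c i * Y i x) * \prod_(j < n) G_ (fun y =>
     cos (c i * y)) j (Y j x) +
   (-1) * (cos (b - pi / 2 + \sum_(i <- s) c i * Y i x) * \prod_(j < n) G_ (fun
     y => sin (c i * y)) j (Y j x)))).
  apply: eq_Rintegral => x _; rewrite !G_x big_cons;
    move: (\sum_(_ <- s) _) => S.
  have -> : b - pi / 2 + S = (b + S) - pi / 2 by ring.
  by rewrite cosBpihalf addrCA (cosD (c i * _)); ring.
rewrite meanD ?meanZ//; try by [exact: bP|apply: bounded_measurableM;
  [exact: bounded_measurable_cst|exact: bP]].
rewrite !IH//; try by [exact: bG_ | exact: G_1].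
rewrite !G_m sin0 big_cons; ring.
Qed.

End independence.

(** * Integrals of the alpha-th power, for any positive alpha *)
Section power_integral.
Context {R : realType}.

(** A substitute for the triangle inequality that holds for every [a > 0] and
    loses only a factor [1 + e] on the main term. Choose [dl] with
    [(1 + dl)^a = 1 + e] and compare [|y|] with [dl |x|]. *)
Lemma powR_normD_le (a e : R) : 0 < a -> 0 < e -> exists2 C : R, 0 <= C &
  forall x y : R, `|x + y| `^ a <= (1 + e) * `|x| `^ a + C * `|y| `^ a.
Proof.
move=> a0 e0; have a1 : a != 0 by rewrite gt_eqF.
pose dl := (1 + e) `^ a^-1 - 1.
have dlE : (1 + dl) `^ a = 1 + e.
  by rewrite /dl addrC subrK -powRrM mulVf// powRr1//; lra.
have dl0 : 0 < dl.
  rewrite subr_gt0; have one : 1 `^ a^-1 = 1 :> R by rewrite powR1.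
  rewrite -[ltLHS]one.
  by apply: gt0_ltr_powR; rewrite ?invr_gt0 ?nnegrE//; lra.
exists ((1 + dl^-1) `^ a); first exact: powR_ge0.
move=> x y; have [xy|xy] := leP `|y| (dl * `|x|).
- apply: (@le_trans _ _ ((1 + e) * `|x| `^ a)).
    rewrite -dlE -powRM//; last by lra.
    apply: ge0_ler_powR; rewrite ?nnegrE ?(ltW a0)// ?mulr_ge0//; first lra.
    by rewrite (le_trans (ler_normD _ _))// mulrDl mul1r lerD2l.
  by rewrite lerDl mulr_ge0 ?powR_ge0.
- apply: (@le_trans _ _ ((1 + dl^-1) `^ a * `|y| `^ a)).
    have di0 : 0 < dl^-1 by rewrite invr_gt0.
    rewrite -powRM//; last by lra.
    apply: ge0_ler_powR; rewrite ?nnegrE ?(ltW a0)// ?mulr_ge0//; first lra.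
    rewrite (le_trans (ler_normD _ _))// mulrDl mul1r addrC lerD2l.
    by rewrite -ler_pdivrMl ?invrK ?invr_gt0// ltW.
  by rewrite lerDr !mulr_ge0 ?powR_ge0//; lra.
Qed.

Context {d : measure_display} {T : measurableType d}.
Variables (mu : {measure set T -> \bar R}) (a : R).
Hypothesis a_gt0 : 0 < a.
Implicit Types f g : T -> R.

(** The [a]-th power of the L^a norm, which is only a quasi-norm when [a < 1]. *)
Definition pint f : \bar R := (\int[mu]_x (`|f x| `^ a)%:E)%E.

Lemma pint_ge0 f : (0 <= pint f)%E.
Proof. by apply: integral_ge0 => x _; rewrite lee_fin powR_ge0. Qed.

Lemma measurable_pint f : measurable_fun setT f ->
  measurable_fun setT (fun x => `|f x| `^ a).
Proof.
move=> mf; apply: (@measurableT_comp _ _ _ _ _ _ (@powR R ^~ a)) => //.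
exact: measurableT_comp.
Qed.

Lemma pintD_le f g (e C : R) : 0 < e -> 0 <= C ->
  (forall x y : R, `|x + y| `^ a <= (1 + e) * `|x| `^ a + C * `|y| `^ a) ->
  measurable_fun setT f -> measurable_fun setT g ->
  (pint (fun x => f x + g x)%R <= (1 + e)%:E * pint f + C%:E * pint g)%E.
Proof.
move=> e0 C0 H mf mg.
have [mpf mpg] := (measurable_pint mf, measurable_pint mg).
have e1 : 0 <= 1 + e by lra.
rewrite /pint -ge0_integralZl ?lee_fin//; last exact/measurable_EFinP.
rewrite -ge0_integralZl ?lee_fin//; last exact/measurable_EFinP.
rewrite -ge0_integralD//; last 4 first.
- by move=> x _; rewrite -EFinM lee_fin mulr_ge0 ?powR_ge0.
- by apply: measurable_funeM; apply/measurable_EFinP; exact: mpf.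
- by move=> x _; rewrite -EFinM lee_fin mulr_ge0 ?powR_ge0.
- by apply: measurable_funeM; exact/measurable_EFinP.
apply: ge0_le_integral => //.
- by apply/measurable_EFinP/measurable_pint; exact: measurable_funD.
- by apply: emeasurable_funD; apply: measurable_funeM; exact/measurable_EFinP.
- by move=> x _; rewrite -!EFinM -EFinD lee_fin H.
Qed.

Lemma pintZ f (c : R) : measurable_fun setT f ->
  pint (fun x => c * f x) = ((`|c| `^ a)%:E * pint f)%E.
Proof.
move=> mf; rewrite /pint -ge0_integralZl//; last first.
  by apply/measurable_EFinP; exact: measurable_pint.
by apply: eq_integral => x _; rewrite normrM powRM// EFinM.
Qed.

Lemma pintD_fin f g : measurable_fun setT f -> measurable_fun setT g ->
  (pint f < +oo)%E -> (pint g < +oo)%E -> (pint (fun x => f x + g x)%R < +oo)%E.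
Proof.
move=> mf mg f_fin g_fin; have [C C0 H] := powR_normD_le a_gt0 (@ltr01 R).
apply: (le_lt_trans (pintD_le ltr01 C0 H mf mg)).
apply: lte_add_pinfty.
  by apply: (lte_mul_pinfty _ _ f_fin); rewrite ?lee_fin.
by apply: (lte_mul_pinfty _ _ g_fin); rewrite ?lee_fin.
Qed.

Lemma pintN f : pint (fun x => - f x) = pint f.
Proof. by apply: eq_integral => x _; rewrite normrN. Qed.

Lemma pint_real f : pint f \is a fin_num ->
  exists2 F : R, 0 <= F & pint f = F%:E.
Proof.
move=> f_fin; exists (fine (pint f)); last by rewrite fineK.
by rewrite fine_ge0// pint_ge0.
Qed.

Lemma lt_scaled_add1 (e F : R) : 0 < e -> 0 <= F -> F * (e / (F + 1)) < e.
Proof.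
move=> e0 F0; have F1 : 0 < F + 1 by lra.
by rewrite mulrCA gtr_pMr// ltr_pdivrMr// mul1r ltrDl.
Qed.

(** Apply [powR_normD_le] in both directions, to [h n = f + (h n - f)] and to
    [f = h n - (h n - f)]: the error is [eps] times a bounded quantity plus a
    constant times [pint (h n - f)]. *)
Lemma pint_cvg (h : nat -> T -> R) f :
  (forall n, measurable_fun setT (h n)) -> measurable_fun setT f ->
  (pint f < +oo)%E -> pint (fun x => h n x - f x) @[n --> \oo] --> 0%E ->
  fine (pint (h n)) @[n --> \oo] --> fine (pint f).
Proof.
move=> mh mf f_fin hf.
have mhf n : measurable_fun setT (fun x => h n x - f x)
    by exact: measurable_funB.
have mhfN n : measurable_fun setT (fun x => - (h n x - f x)).
  exact: measurableT_comp.
have [F F0 pf] : exists2 F : R, 0 <= F & pint f = F%:E.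
  by apply: pint_real; rewrite (ge0_fin_numE (pint_ge0 f)).
rewrite pf /=; apply/cvgrPdist_lt => e e0.
have e4 : 0 < e / 4 by rewrite divr_gt0.
have [eps [eps0 eps1 epsF]] : exists eps : R,
    [/\ 0 < eps, eps <= 1 & F * eps < e / 4].
  exists (Num.min 1 (e / 4 / (F + 1))); split.
  - by rewrite lt_min ltr01 divr_gt0//; lra.
  - by rewrite ge_min lexx.
  - apply: le_lt_trans (lt_scaled_add1 e4 F0).
    by rewrite ler_wpM2l// ge_min lexx orbT.
have [C C0 H] := powR_normD_le a_gt0 eps0.
have [h_fin hF] := (fine_cvgP _ _).1 hf.
have dl0 : 0 < e / 4 / (C + 1) by rewrite divr_gt0//; lra.
move/cvgrPdist_lt : hF => /(_ _ dl0) hF.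
near=> n.
have hn_fin : pint (fun x => h n x - f x) \is a fin_num by near: n.
have : `|0 - fine (pint (fun x => h n x - f x))| < e / 4 / (C + 1).
  by near: n.
have [D D0 Dp] := pint_real hn_fin.
rewrite Dp /= sub0r normrN ger0_norm// => DC.
have CD : C * D < e / 4.
  by apply: le_lt_trans (lt_scaled_add1 e4 C0); rewrite ler_wpM2l// ltW.
have up : (pint (h n) <= ((1 + eps) * F + C * D)%:E)%E.
  rewrite EFinD !EFinM -pf -Dp; apply: le_trans (pintD_le eps0 C0 H mf (mhf n)).
  rewrite le_eqVlt; apply/orP; left; apply/eqP; congr pint.
  by apply/funext => x; rewrite addrC subrK.
have [G G0 pg] : exists2 G : R, 0 <= G & pint (h n) = G%:E.
  apply: pint_real; rewrite (ge0_fin_numE (pint_ge0 (h n))).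
  exact: le_lt_trans up (ltry _).
have lo : (pint f <= ((1 + eps) * G + C * D)%:E)%E.
  rewrite EFinD !EFinM -pg -Dp -(pintN (fun x => h n x - f x)).
  apply: le_trans (pintD_le eps0 C0 H (mh n) (mhfN n)).
  rewrite le_eqVlt; apply/orP; left; apply/eqP; congr pint.
  by apply/funext => x; rewrite opprB addrC subrK.
move: up lo; rewrite pf pg !lee_fin => up lo.
rewrite /= ltr_norml; apply/andP; split; first lra.
have : eps * G <= eps * ((1 + eps) * F + C * D) by rewrite ler_wpM2l// ltW.
have : eps * (C * D) <= C * D by rewrite ler_piMl// mulr_ge0.
have : eps * (eps * F) <= eps * F by rewrite ler_piMl// mulr_ge0// ltW.
lra.
Unshelve. all: by end_near.
Qed.

End power_integral.

(** * Convergence in probability *)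
Section convergence_in_probability.
Context {d : measure_display} {T : measurableType d} {R : realType}.
Context (P : probability T R).
Implicit Types (Y V U : nat -> T -> R).

Lemma measurable_deviation (f g : T -> R) (e : R) :
  measurable_fun setT f -> measurable_fun setT g ->
  measurable [set w | e <= `|f w - g w|].
Proof.
move=> mf mg.
have mh : measurable_fun setT (fun w => `|f w - g w|).
  by apply: measurableT_comp => //; exact: measurable_funB.
have := mh measurableT _ (measurable_itv `[e, +oo[); rewrite setTI.
by congr measurable; apply/seteqP; split => w /=; rewrite in_itv/= andbT.
Qed.

Lemma cos_uniform_continuous (e : R) : 0 < e -> exists2 dl : R, 0 < dl &
  forall u v : R, `|u - v| < dl -> `|cos u - cos v| <= e.
Proof.
move=> e0; have e2 : 0 < e / 2 by rewrite divr_gt0.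
have /cvgrPdist_lt /(_ _ e2) [d1 /= d10 c1] := @continuous_cos R 0.
have /cvgrPdist_lt /(_ _ e2) [d2 /= d20 s1] := @continuous_sin R 0.
exists (Num.min d1 d2); first by rewrite lt_min d10.
move=> u v; rewrite lt_min => /andP[uv1 uv2].
have := c1 (u - v); have := s1 (u - v); rewrite /ball_/= !sub0r !normrN.
move=> /(_ uv2) + /(_ uv1); rewrite sin0 cos0 sub0r normrN.
move: (u - v) (subrK v u) => z <- sz cz; rewrite cosD.
have -> : cos z * cos v - sin z * sin v - cos v =
  - ((1 - cos z) * cos v) - sin z * sin v by ring.
have cv : `|cos v| <= 1 by rewrite ler_norml cos_geN1 cos_le1.
have sv : `|sin v| <= 1 by rewrite ler_norml sin_geN1 sin_le1.
rewrite (le_trans (ler_normB _ _))// normrN !normrM [leRHS]splitr lerD//.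
  by apply: (le_trans (ler_piMr _ cv)) => //; exact: ltW.
by apply: (le_trans (ler_piMr _ sv)) => //; exact: ltW.
Qed.

(** The cosines differ by little where the variables are close, and by at most 2
    on the complementary event, whose probability tends to 0. *)
Lemma cvg_in_probability_mean_cos Y (Y0 : T -> R) (b : R) :
  (forall n, measurable_fun setT (Y n)) -> measurable_fun setT Y0 ->
  cvg_in_probability P Y Y0 ->
  \int[P]_w cos (b + Y n w) @[n --> \oo] --> \int[P]_w cos (b + Y0 w).
Proof.
move=> mY mY0 Ycvg; apply/cvgrPdist_le => e e0.
have e2 : 0 < e / 2 by rewrite divr_gt0.
have e4 : 0 < e / 4 by rewrite divr_gt0.
have [dl dl0 cos_dl] := cos_uniform_continuous e2.
have /fine_cvgP[_ /cvgrPdist_lt /(_ _ e4) Pcvg] := Ycvg _ dl0.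
have bc (f : T -> R) : measurable_fun setT f ->
    bounded_measurable (fun w => cos (b + f w)).
  by move=> mf; apply: bounded_measurable_cos; exact: measurable_funD.
near=> n.
have PA : `|0 - fine (P [set w | dl <= `|Y n w - Y0 w|])| < e / 4 by near: n.
pose A := [set w | dl <= `|Y n w - Y0 w|].
have mA : measurable A by exact: measurable_deviation.
have {}PA : fine (P A) < e / 4.
  by move: PA; rewrite sub0r normrN; apply: le_lt_trans; exact: ler_norm.
have bW : bounded_measurable (fun w => cos (b + Y0 w) + (-1) * cos (b + Y n w)).
  apply: bounded_measurableD; first exact: bc.
  by apply: bounded_measurableM; [exact: bounded_measurable_cst|exact: bc].
have -> : \int[P]_w cos (b + Y0 w) - \int[P]_w cos (b + Y n w) =
    \int[P]_w (cos (b + Y0 w) + (-1) * cos (b + Y n w)).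
  rewrite meanD ?meanZ ?mulN1r//; try exact: bc.
  by apply: bounded_measurableM; [exact: bounded_measurable_cst|exact: bc].
have b2A : bounded_measurable (fun w => 2 * \1_A w : R).
  by apply: bounded_measurableM; [exact: bounded_measurable_cst|exact:
    bounded_measurable_indic].
have bE : bounded_measurable (fun w => e / 2 + 2 * \1_A w).
  by apply: bounded_measurableD => //; exact: bounded_measurable_cst.
apply: (le_trans (le_normr_Rintegral measurableT (bounded_measurable_integrable
  P bW))).
have : \int[P]_w `|cos (b + Y0 w) + (-1) * cos (b + Y n w)| <=
    \int[P]_w (e / 2 + 2 * \1_A w).
  apply: le_Rintegral => //.
  - apply: bounded_measurable_integrable; have [mW [K WK]] := bW.
    by split; [exact: measurableT_comp|exists K => w; rewrite normr_id].
  - exact: bounded_measurable_integrable.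
  move=> w _; rewrite mulN1r indicE.
  have [wA|wA] := boolP (w \in A).
    rewrite (le_trans (ler_normB _ _))// mulr1.
    have c1 (z : R) : `|cos z| <= 1 by rewrite ler_norml cos_geN1 cos_le1.
    by have := c1 (b + Y0 w); have := c1 (b + Y n w); lra.
  rewrite mulr0 addr0 distrC; apply: cos_dl.
  rewrite opprD addrACA subrr add0r ltNge; apply/negP => /mem_set.
  exact/negP.
move=> h; apply: (le_trans h).
have be2 : bounded_measurable (fun _ : T => e
    / 2) by exact: bounded_measurable_cst.
rewrite (meanD P be2 b2A) (meanZ P 2 (bounded_measurable_indic mA)).
rewrite mean_indic// Rintegral_cst//.
have -> : fine (P setT) = 1 by rewrite probability_setT.
by move: PA; lra.
Unshelve. all: by end_near.
Qed.

(** The relation between [U], [Y] and [V] is only required almost surely, as that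
    is how simple integrals depend on their integrands. *)
Lemma cvg_in_probability_linear (a : R) Y V U (Y0 V0 : T -> R) :
  (forall n, measurable_fun setT (Y n)) -> measurable_fun setT Y0 ->
  (forall n, measurable_fun setT (V n)) -> measurable_fun setT V0 ->
  (forall n, measurable_fun setT (U n)) ->
  (forall n, {ae P, forall w, U n w = a * Y n w + V n w}) ->
  cvg_in_probability P Y Y0 -> cvg_in_probability P V V0 ->
  cvg_in_probability P U (fun w => a * Y0 w + V0 w).
Proof.
move=> mY mY0 mV mV0 mU UE Ycvg Vcvg e e0.
(* half of the deviation e is allotted to each term; the +1 covers a = 0 *)
pose e1 := e / (2 * (`|a| + 1)).
have a1 : 0 < `|a| + 1 by rewrite ltr_wpDl.
have e10 : 0 < e1 by rewrite divr_gt0// mulr_gt0.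
have e20 : 0 < e / 2 by rewrite divr_gt0.
have := cvgeD _ (Ycvg _ e10) (Vcvg _ e20); rewrite adde0 => /(_ _ isT).
apply: (squeeze_cvge _ (cvg_cst 0%E)).
apply: nearW => n; rewrite measure_ge0/=.
have [N [mN PN subN]] := UE n.
have mA := measurable_deviation e1 (mY n) mY0.
have mB := measurable_deviation (e / 2) (mV n) mV0.
have mC : measurable [set w | e <= `|U n w - (a * Y0 w + V0 w)|].
  apply: measurable_deviation => //; apply: measurable_funD => //.
  exact: measurable_funM.
have <- : P ([set w | e1 <= `|Y n w - Y0 w|] `|` N) =
    P [set w | e1 <= `|Y n w - Y0 w|].
  by rewrite measureU0.
apply: (@le_trans _ _ (P (([set w | e1 <= `|Y n w - Y0 w|] `|` N) `|`
    [set w | e / 2 <= `|V n w - V0 w|]))); last first.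
  by apply: measureU2 => //; exact: measurableU.
apply: (le_measure _ (mem_set mC) (mem_set (measurableU _ _ (measurableU _ _ mA
  mN) mB))).
move=> w /= ew; apply: contrapT => /not_orP[/not_orP[/negP Aw Nw] /negP Bw].
have UwE : U n w = a * Y n w + V n w by apply: contrapT => h; apply: Nw;
    exact: subN.
move: Aw Bw ew; rewrite -!ltNge UwE => Aw Bw; apply/negP; rewrite -ltNge.
have -> : a * Y n w + V n w - (a * Y0 w + V0 w) =
    a * (Y n w - Y0 w) + (V n w - V0 w) by ring.
apply: (le_lt_trans (ler_normD _ _)); rewrite normrM [ltRHS]splitr.
apply: ler_ltD => //; apply: (@le_trans _ _ (`|a| * e1)).
  by rewrite ler_wpM2l// ltW.
have -> : `|a| * e1 = e / 2 * (`|a| / (`|a| + 1)) by rewrite /e1; field;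
    rewrite gt_eqF.
by apply: ler_piMr; rewrite ?(ltW e20)// ler_pdivrMr// mul1r lerDl.
Qed.

End convergence_in_probability.

(** * Integrals of simple functions against a stable random measure *)
Section almost_everywhere_seq.
Context {d : measure_display} {T : measurableType d} {R : realType}.
Context (P : {measure set T -> \bar R}).

Lemma ae_all_seq (I : eqType) (s : seq I) (Q : I -> T -> Prop) :
  (forall i, i \in s -> {ae P, forall w, Q i w}) ->
  {ae P, forall w, forall i, i \in s -> Q i w}.
Proof.
elim: s => [|i s IH] H; first by apply: aeW.
have Hi : {ae P, forall w, Q i w} by apply: H; rewrite inE eqxx.
have Hs : {ae P, forall w, forall j, j \in s -> Q j w}.
  by apply: IH => j js; apply: H; rewrite inE js orbT.
apply: filterS2 Hi Hs => w Qi Qs j; rewrite inE => /predU1P[->//|]; exact: Qs.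
Qed.

End almost_everywhere_seq.

Section stable_random_measure.
Context {dO : measure_display} {Omega : measurableType dO} {R : realType}.
Context (P : probability Omega R) (d : nat) (alpha : R).
Hypothesis alpha_gt0 : 0 < alpha.
Variable Z : set 'cV[R]_d -> {RV P >-> R}.
Hypothesis hZ : sas_random_measure alpha Z.
Implicit Types (A B : set 'cV[R]_d) (g h : {sfun 'cV[R]_d >-> R}).

Let nu := lebesgue_cV (R := R) d.

Lemma sas_mean_cos A (t : R) : measurable A -> (nu A < +oo)%E ->
  \int[P]_w cos (t * Z A w) = expR (- (`|t| `^ alpha * fine (nu A))).
Proof.
move=> mA A_fin; have [/(_ A mA A_fin t) + _ _] := hZ.
by rewrite /charfun unlock => -[].
Qed.

Lemma sas_mean_sin A (t : R) : measurable A -> (nu A < +oo)%E ->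
  \int[P]_w sin (t * Z A w) = 0.
Proof.
move=> mA A_fin; have [/(_ A mA A_fin t) + _ _] := hZ.
by rewrite /charfun unlock => -[].
Qed.

(** The constant series with term [Z set0] converges, so its term is 0. *)
Lemma sas_set0 : {ae P, forall w, Z set0 w = 0}.
Proof.
have [_ _ /(_ (fun=> set0))] := hZ; rewrite bigcup0// measure0.
have t0 : trivIset [set: nat] (fun=> set0 : set 'cV[R]_d).
  by apply/trivIsetP => i j _ _ _; rewrite set0I.
move=> /(_ (fun=> measurable0) (ltry _) t0).
apply: filterS => w Zw.
have : (fun=> Z set0 w) @ \oo --> (0 : R).
  by apply: (@cvg_series_cvg_0 _ _ (fun=> Z set0 w)); apply/cvg_ex;
    exists (Z set0 w).
by move/(cvg_unique _ (cvg_cst _)) ->.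
Qed.

(** Countable additivity for the sequence [A, B, set0, set0, ...]. *)
Lemma sas_setU A B : measurable A -> measurable B -> A `&` B = set0 ->
  (nu A < +oo)%E -> (nu B < +oo)%E ->
  {ae P, forall w, Z (A `|` B) w = Z A w + Z B w}.
Proof.
move=> mA mB AB A_fin B_fin; have [_ _ /(_ (bigcup2 A B))] := hZ.
rewrite bigcup2E => H.
have U_fin : (nu (A `|` B) < +oo)%E.
  by apply: le_lt_trans (measureU2 _ mA mB) _; rewrite lte_add_pinfty.
have mAB i : measurable (bigcup2 A B i) by rewrite /bigcup2;
    case: ifP => // _; case: ifP.
have tAB : trivIset setT (bigcup2 A B).
  by apply/trivIsetP => -[|[|i]] [|[|j]] _ _ //= _;
    rewrite ?set0I ?setI0// setIC.
apply: filterS2 sas_set0 (H mAB U_fin tAB) => w Z0 ZU.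
suff lim : series (fun i => Z (bigcup2 A B i) w) @ \oo --> Z A w + Z B w.
  exact: cvg_unique ZU lim.
apply: cvg_near_cst.
near=> n.
have n2 : (2 <= n)%N by near: n; exact: nbhs_infty_ge.
rewrite /series/= (big_cat_nat (leq0n 2) n2)/=.
rewrite [X in _ + X]big1_seq ?addr0.
  by rewrite big_ltn// big_nat1.
by move=> [|[|i]]; rewrite mem_index_iota => /andP[_ i2].
Unshelve. all: by end_near.
Qed.

Lemma sas_bigsetU (I : choiceType) (s : seq I) (D : I -> set 'cV[R]_d) :
  uniq s -> trivIset [set` s] D ->
  (forall i, i \in s -> measurable (D i)) ->
  (forall i, i \in s -> (nu (D i) < +oo)%E) ->
  {ae P, forall w, Z (\big[setU/set0]_(i <- s) D i) w =
    \sum_(i <- s) Z (D i) w}.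
Proof.
elim: s => [_ _ _ _|i s IH /= /andP[ins us] tD mD D_fin].
  by rewrite big_nil; apply: filterS sas_set0 => w; rewrite big_nil.
have si j : j \in s -> j \in i :: s by rewrite inE => ->; rewrite orbT.
have ii : i \in i :: s by rewrite inE eqxx.
have {}IH := IH us (sub_trivIset si tD) (fun j js => mD j (si j js))
  (fun j js => D_fin j (si j js)).
have [mDs Ds_fin] : measurable (\big[setU/set0]_(j <- s) D j) /\
    (nu (\big[setU/set0]_(j <- s) D j) < +oo)%E.
  rewrite big_seq; elim/big_ind : _ => [|A B [mA A_fin] [mB B_fin]|j /si js].
  - by rewrite measure0 ltry.
  - split; first exact: measurableU.
    by apply: le_lt_trans (measureU2 _ mA mB) _; rewrite lte_add_pinfty.
  - by split; [exact: mD|exact: D_fin].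
have disj : D i `&` \big[setU/set0]_(j <- s) D j = set0.
  rewrite -bigcup_seq setI_bigcupr bigcup0// => j js.
  move/trivIsetP : tD => /(_ i j ii (si _ js)); apply.
  by apply: contraNneq ins => ->.
rewrite big_cons.
apply: filterS2 IH (sas_setU (mD _ ii) mDs disj (D_fin _ ii) Ds_fin) =>
  w IHw ->.
by rewrite big_cons IHw.
Qed.

Lemma measurable_sfun_neq0 g : measurable [set x | g x != 0].
Proof.
rewrite (_ : mkset _ = ~` (g @^-1` [set 0])).
  by apply: measurableC; exact: measurable_sfunP.
by apply/seteqP; split => x /=; [move=> /eqP|move/eqP].
Qed.

(** A simple integral may be computed on any finite partition on whose cells the
    integrand is constant, which lets two integrands share one partition.
    Cells where the integrand is 0 may have infinite measure; their coefficient
    is 0. Cells may also be empty, with an arbitrary coefficient [v i]; there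
    [Z] vanishes almost surely. *)
Lemma simple_integral_partition (I : choiceType) (s : seq I)
    (D : I -> set 'cV[R]_d) (v : I -> R) g :
  uniq s -> trivIset [set` s] D -> (forall i, measurable (D i)) ->
  (forall x, exists2 i, i \in s & D i x) ->
  (forall i x, i \in s -> D i x -> g x = v i) ->
  (nu [set x | g x != 0%R] < +oo)%E ->
  {ae P, forall w, simple_stable_integral Z g w =
    \sum_(i <- s) v i * Z (D i) w}.
Proof.
move=> us tD mD cD gD g_fin; pose F := fset_set (range g).
have mg := measurable_sfun_neq0 g.
have D_fin i : i \in s -> v i != 0 -> (nu (D i) < +oo)%E.
  move=> si vi0; apply: le_lt_trans g_fin; apply: (le_measure _ (mem_set (mD
    i)) (mem_set mg)).
  by move=> x Dix /=; rewrite (gD i).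
have Hr (r : R) : r \in enum_fset F -> {ae P, forall w,
    r * Z (g @^-1` [set r]) w = \sum_(i <- s | v i == r) v i * Z (D i) w}.
  move=> rF; have [->|r0] := eqVneq r 0.
    apply: aeW => w; rewrite mul0r big1// => i /eqP ->; exact: mul0r.
  have mem_s' i : i \in [seq i <- s | v i == r] -> i \in s /\ v i = r.
    by rewrite mem_filter => /andP[/eqP].
  have -> : g @^-1` [set r] = \big[setU/set0]_(i <- [seq i <- s | v i == r]) D
      i.
    rewrite -bigcup_seq; apply/seteqP; split => x /=.
      move=> gx; have [i si Dix] := cD x; exists i => //=.
      by rewrite mem_filter si andbT -(gD i x)// gx.
    by move=> [i /= /mem_s'[si vi] Dix]; rewrite (gD i).
  have tD' : trivIset [set` [seq i <- s | v i == r]] D.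
    by apply: sub_trivIset tD => i /= /mem_s'[].
  have fin' i : i \in [seq i <- s | v i == r] -> (nu (D i) < +oo)%E.
    by move=> /mem_s'[si vi]; apply: D_fin => //; rewrite vi.
  apply: filterS (sas_bigsetU (filter_uniq _ us) tD' (fun i _ =>
    mD i) fin') => w ->.
  by rewrite mulr_sumr big_filter; apply: eq_bigr => i /eqP ->.
have Hi i : i \in s -> {ae P, forall w, v i \notin enum_fset F ->
    Z (D i) w = 0}.
  move=> si; have [->|/set0P[x Dix]] := eqVneq (D i) set0.
    by apply: filterS sas_set0 => w.
  have giF : g x \in F by rewrite in_fset_set; [apply/mem_set;
      exists x|exact: fimfunP].
  by apply: aeW => w /negP[]; rewrite -(gD i x).
apply: filterS2 (ae_all_seq Hr) (ae_all_seq Hi) => w {}Hr {}Hi.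
rewrite /simple_stable_integral fsbig_finite; last exact: fimfunP.
rewrite big_seq (eq_bigr _ (fun r rF => Hr r rF)) -big_seq.
under eq_bigr do rewrite big_mkcond.
rewrite exchange_big/= [LHS]big_seq [RHS]big_seq; apply: eq_bigr => i si.
have [viF|viF] := boolP (v i \in enum_fset F).
  rewrite (bigD1_seq (v i)) ?fset_uniq//= eqxx big1 ?addr0//.
  by move=> r /negPf; rewrite eq_sym => ->.
rewrite Hi// mulr0 big1_seq// => r /andP[_ rF]; by case: eqP viF => // ->;
  rewrite rF.
Qed.

Lemma measurable_simple_stable_integral g :
  measurable_fun setT (simple_stable_integral Z g).
Proof.
rewrite /simple_stable_integral; under eq_fun do rewrite fsbig_finite//=.
by apply: measurable_sum => r; exact: measurable_funM.
Qed.

(** Packaged as a simple function, so that it can be integrated. *)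
Definition sfun_lin (a : R) g h : {sfun 'cV[R]_d >-> R} := cst_sfun a * g + h.

Lemma sfun_linE (a : R) g h :
  sfun_lin a g h =1 (fun x => a * g x + h x).
Proof. by []. Qed.

(** Compute the three integrals on the common refinement of the level sets. *)
Lemma simple_stable_integral_linear (a : R) g h :
  (nu [set x | g x != 0%R] < +oo)%E -> (nu [set x | h x != 0%R] < +oo)%E ->
  (nu [set x | sfun_lin a g h x != 0%R] < +oo)%E /\
  {ae P, forall w,
    simple_stable_integral Z (sfun_lin a g h) w =
    a * simple_stable_integral Z g w + simple_stable_integral Z h w}.
Proof.
move=> g_fin h_fin.
have m0 := measurable_sfun_neq0.
have k_fin : (nu [set x | sfun_lin a g h x != 0%R] < +oo)%E.
  apply: (@le_lt_trans _ _ (nu ([set x | g x != 0] `|` [set x | h x != 0]))).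
    apply: (le_measure _ (mem_set (m0 _)) (mem_set (measurableU _ _ (m0 g) (m0
      h)))).
    move=> x; change (a * g x + h x != 0 -> g x != 0 \/ h x != 0).
    have [->|] := eqVneq (g x) 0; last by left.
    by rewrite mulr0 add0r; right.
  by apply: le_lt_trans (measureU2 _ (m0 g) (m0 h)) _; rewrite lte_add_pinfty.
split => //.
pose s := [seq (r, q) | r <- enum_fset (fset_set (range g)),
  q <- enum_fset (fset_set (range h))].
pose D (p : R * R) := g @^-1` [set p.1] `&` h @^-1` [set p.2].
have us : uniq s by rewrite allpairs_uniq ?fset_uniq// => -[? ?] [? ?].
have tD : trivIset [set` s] D.
  move=> [r q] [r' q'] _ _ [x [[/= <- <-] [/= <- <-]]]; done.
have mD p : measurable (D p) by apply: measurableI; exact: measurable_sfunP.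
have cD x : exists2 p, p \in s & D p x.
  exists (g x, h x) => //; apply/allpairsP; exists (g x, h x); split => //=.
  - by rewrite in_fset_set; [apply/mem_set; exists x|exact: fimfunP].
  - by rewrite in_fset_set; [apply/mem_set; exists x|exact: fimfunP].
have vk p x : p \in s -> D p x ->
    sfun_lin a g h x = a * p.1 + p.2.
  by move=> _ [/= gx hx]; change (a * g x + h x = a * p.1 + p.2); rewrite gx hx.
have vg p x : p \in s -> D p x -> g x = p.1 by move=> _ [].
have vh p x : p \in s -> D p x -> h x = p.2 by move=> _ [].
have Ik := simple_integral_partition us tD mD cD vk k_fin.
have Ig := simple_integral_partition us tD mD cD vg g_fin.
have Ih := simple_integral_partition us tD mD cD vh h_fin.
apply: filterS3 Ik Ig Ih => w -> -> ->.
rewrite mulr_sumr -big_split/=; apply: eq_bigr => p _.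
by rewrite mulrDl mulrA.
Qed.

(** The values of [Z] on the level sets of [g] are independent, and the exponents
    [|r|^alpha nu (g = r)] add up to the integral of [|g|^alpha]. *)
Lemma simple_stable_integral_mean_cos (b : R) g :
  (nu [set x | g x != 0%R] < +oo)%E ->
  \int[P]_w cos (b + simple_stable_integral Z g w) =
  cos b * expR (- fine (pint nu alpha g)).
Proof.
move=> g_fin.
pose F := enum_fset (fset_set (range g)).
(* the value 0 is left out: its level set may have infinite measure *)
pose s := [seq r <- F | r != 0]; pose r i := nth 0 s i.
pose A (i : 'I_(size s)) := g @^-1` [set r i].
have us : uniq s by apply: filter_uniq; exact: fset_uniq.
have r0 (i : 'I_(size s)) : r i != 0.
  by have := mem_nth 0 (ltn_ord i); rewrite mem_filter => /andP[].
have m0 := measurable_sfun_neq0 g.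
have mA i : measurable (A i) by exact: measurable_sfunP.
have A_fin i : (nu (A i) < +oo)%E.
  apply: le_lt_trans g_fin; apply: (le_measure _ (mem_set (mA i)) (mem_set m0)).
  by move=> x Aix; rewrite /mkset (Aix : g x = r i).
have tA : trivIset setT A.
  move=> i j _ _ [x [Ai Aj]]; apply/val_inj/eqP.
  by rewrite -(nth_uniq 0 (ltn_ord i) (ltn_ord j) us) -/(r i) -/(r j) -(Ai : g
    x = r i) -(Aj : g x = r j).
have [_ /(_ _ A mA A_fin tA) indZ _] := hZ.
have mZ i : measurable_fun setT (Z (A i)) by [].
transitivity (\int[P]_w cos (b + \sum_(i < size s) r i * Z (A i) w)).
  apply: eq_Rintegral => w _; congr (cos (_ + _)).
  rewrite /simple_stable_integral fsbig_finite; last exact: fimfunP.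
  rewrite (bigID (fun r => r != 0))/= [X in _ + X]big1 ?addr0; last first.
    by move=> q; rewrite negbK => /eqP ->; rewrite mul0r.
  by rewrite -big_filter (big_nth 0) big_mkord.
rewrite (mean_cos_sum_indep mZ indZ); last by move=> i; exact: sas_mean_sin.
congr (_ * _).
have -> : pint nu alpha g = (\sum_(i < size s) `|r i| `^ alpha * fine (nu (A
    i)))%:E.
  transitivity (\int[nu]_x \sum_(i < size s) (`|r i| `^ alpha * \1_(A i)
    x)%:E)%E.
    apply: eq_integral => x _; rewrite sumEFin; congr EFin.
    have [gx|gx] := eqVneq (g x) 0.
      rewrite gx normr0 powR0 ?gt_eqF// big1// => i _.
      rewrite indicE memNset ?mulr0// /A/= gx => /esym/eqP.
      by rewrite (negPf (r0 i)).
    have gs : g x \in s.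
      rewrite mem_filter gx/=.
      by rewrite in_fset_set; [apply/mem_set; exists x|exact: fimfunP].
    have gi : (index (g x) s < size s)%N by rewrite index_mem.
    have ri : r (Ordinal gi) = g x by rewrite /r nth_index.
    rewrite (bigD1 (Ordinal gi))//= ri indicE mem_set// mulr1 big1 ?addr0//.
    move=> i; rewrite -val_eqE/= => /eqP ii; rewrite indicE memNset ?mulr0//
      /A/= => gri.
    by apply: ii; rewrite gri /r index_uniq.
  rewrite ge0_integral_sum//; last first.
    by move=> i; apply/measurable_EFinP; exact: measurable_funM.
  rewrite -sumEFin; apply: eq_bigr => i _.
  under eq_integral do rewrite EFinM.
  rewrite ge0_integralZl// ?lee_fin ?powR_ge0//; last first.
    by apply/measurable_EFinP; exact: measurable_indic.
  by rewrite integral_indic// setIT EFinM fineK// ge0_fin_numE.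
rewrite /= -sumrN expR_sum; apply: eq_bigr => i _.
exact: sas_mean_cos.
Qed.

End stable_random_measure.

(** * Stable integrals and the fields they define *)
Section stable_integral.
Context {dO : measure_display} {Omega : measurableType dO} {R : realType}.
Context (P : probability Omega R) (d : nat) (alpha : R).
Hypothesis alpha_gt0 : 0 < alpha.
Variable Z : set 'cV[R]_d -> {RV P >-> R}.
Hypothesis hZ : sas_random_measure alpha Z.
Implicit Types (f : 'cV[R]_d -> R) (Y : Omega -> R).

Let nu := lebesgue_cV (R := R) d.

Lemma stable_integral0 : is_stable_integral alpha Z (fun=> 0) (fun=> 0).
Proof.
have p0 : pint nu alpha (fun=> 0) = 0%E.
  by apply: integral0_eq => x _; rewrite normr0 powR0 ?gt_eqF.
split=> //; first by rewrite -/(pint nu alpha (fun=> 0)) p0 ltry.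
exists (fun=> cst_sfun 0); split.
- move=> _; rewrite (_ : mkset _ = set0) ?measure0 ?ltry//.
  by apply/seteqP; split => // x /=; rewrite eqxx.
- apply: cvg_near_cst; apply: nearW => _; rewrite -[RHS]p0.
  by apply: eq_integral => x _ /=; rewrite subr0.
- move=> e e0; apply: cvg_near_cst; apply: nearW => _.
  rewrite (_ : mkset _ = set0) ?measure0//; apply/seteqP; split => // w /=.
  rewrite subr0 /simple_stable_integral fsbig1 ?normr0 => [|r [x _ <-]].
    by rewrite leNgt e0.
  by rewrite mul0r.
Qed.

(** Approximate both kernels and combine the approximations. *)
Lemma stable_integral_linear (a : R) f Y f' Y' :
  measurable_fun setT Y -> measurable_fun setT Y' ->
  is_stable_integral alpha Z f Y -> is_stable_integral alpha Z f' Y' ->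
  is_stable_integral alpha Z (fun x => a * f x + f' x) (fun w =>
    a * Y w + Y' w).
Proof.
move=> mY mY' [mf f_fin [g [g_fin gf gY]]] [mf' f'_fin [h [h_fin hf' hY']]].
have maf (u : 'cV[R]_d -> R) : measurable_fun setT u ->
    measurable_fun setT (fun x => a * u x).
  by move=> mu; exact: measurable_funM.
split.
- by apply: measurable_funD => //; exact: maf.
- change (pint nu alpha (fun x => (a * f x + f' x)%R) < +oo)%E.
  apply: (pintD_fin alpha_gt0 (maf f mf) mf' _ f'_fin).
  rewrite (pintZ nu alpha a mf).
  by apply: (lte_mul_pinfty _ _ f_fin); rewrite ?lee_fin ?powR_ge0.
exists (fun n => sfun_lin a (g n) (h n)); split.
- by move=> n; have [] := simple_stable_integral_linear hZ a (g_fin n) (h_fin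
  n).
- have mgf n : measurable_fun setT (fun x => g n x - f x)
  by exact: measurable_funB.
  have mhf n : measurable_fun setT (fun x => h n x - f' x)
      by exact: measurable_funB.
  have [C C0 H] := powR_normD_le alpha_gt0 (@ltr01 R).
  have lim : ((1 + 1)%:E * ((`|a| `^ alpha)%:E * pint nu alpha (fun x =>
      g n x - f x)%R)
    + C%:E * pint nu alpha (fun x => h n x - f' x)%R)%E @[n --> \oo] --> 0%E.
    have cvgZ0 (c : R) (u : nat -> \bar R) :
        u n @[n --> \oo] --> 0%E -> (c%:E * u n)%E @[n --> \oo] --> 0%E.
      by move=> u0; rewrite -[X in _ --> X](mule0 c%:E); exact: cvgeZl.
    rewrite -[X in _ --> X](adde0 0%E); apply: cvgeD => //;
      last by apply: (cvgZ0).
    exact: cvgZ0 _ _ (cvgZ0 _ _ gf).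
  apply: (squeeze_cvge _ (cvg_cst 0%E) lim); apply: nearW => n.
  rewrite -/(pint nu alpha (fun x => sfun_lin a (g n) (h n) x - (a * f x + f'
    x))).
  rewrite pint_ge0/= -pintZ//.
  have -> : (fun x => sfun_lin a (g n) (h n) x - (a * f x + f' x)) =
      (fun x => a * (g n x - f x) + (h n x - f' x)).
    by apply/funext => x; rewrite sfun_linE; ring.
  by apply: pintD_le => //; exact: maf.
apply: (cvg_in_probability_linear _ mY _ mY' _ _ gY hY').
- by move=> n; exact: measurable_simple_stable_integral.
- by move=> n; exact: measurable_simple_stable_integral.
- by move=> n; exact: measurable_simple_stable_integral.
- by move=> n; have [] := simple_stable_integral_linear hZ a (g_fin n) (h_fin
  n).
Qed.

Lemma stable_integral_sum (I : Type) (s : seq I) (t : I -> R)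
    (f : I -> 'cV[R]_d -> R) (Y : I -> Omega -> R) :
  (forall i, measurable_fun setT (Y i)) ->
  (forall i, is_stable_integral alpha Z (f i) (Y i)) ->
  is_stable_integral alpha Z (fun x => \sum_(i <- s) t i * f i x)
    (fun w => \sum_(i <- s) t i * Y i w).
Proof.
move=> mY fY; elim: s => [|i s IH].
  under eq_fun do rewrite big_nil.
  by under [X in is_stable_integral _ _ _ X]eq_fun do rewrite big_nil;
    exact: stable_integral0.
under eq_fun do rewrite big_cons.
under [X in is_stable_integral _ _ _ X]eq_fun do rewrite big_cons.
apply: stable_integral_linear => //.
by apply: measurable_sum => j; exact: measurable_funM.
Qed.

(** The characteristic function [exp (- int |f|^alpha)], with a phase [b]: [b = 0]
    gives its real part and [b = - pi / 2] its vanishing imaginary part. *)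
Lemma stable_integral_mean_cos (b : R) f Y :
  measurable_fun setT Y -> is_stable_integral alpha Z f Y ->
  \int[P]_w cos (b + Y w) = cos b * expR (- fine (pint nu alpha f)).
Proof.
move=> mY [mf f_fin [g [g_fin gf gY]]].
have mI n : measurable_fun setT (simple_stable_integral Z (g n)).
  exact: measurable_simple_stable_integral.
have lim := cvg_in_probability_mean_cos (b := b) mI mY gY.
have lim' : cos b * expR (- fine (pint nu alpha (g n))) @[n --> \oo] -->
    cos b * expR (- fine (pint nu alpha f)).
  apply: cvgMr; apply: (continuous_cvg _ (@continuous_expR R _)); apply: cvgN.
  exact: (pint_cvg alpha_gt0).
move: lim.
under eq_fun do rewrite (simple_stable_integral_mean_cos alpha_gt0 hZ b (g_fin
  _)).
by move/cvg_unique => /(_ _ _ lim') ->.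
Qed.

(** A linear combination of stable integrals is the stable integral of the
    combined kernel, so the hypothesis makes the characteristic functions of all
    finite-dimensional marginals agree. *)
Lemma stable_integral_same_fdd (T : Type) (f f' : T -> 'cV[R]_d -> R)
    (Y Y' : T -> Omega -> R) :
  (forall x, measurable_fun setT (Y x)) -> (forall x,
    measurable_fun setT (Y' x)) ->
  (forall x, is_stable_integral alpha Z (f x) (Y x)) ->
  (forall x, is_stable_integral alpha Z (f' x) (Y' x)) ->
  (forall (n : nat) (x : 'I_n -> T) (t : 'I_n -> R),
    pint nu alpha (fun y => \sum_(i < n) t i * f (x i) y) =
    pint nu alpha (fun y => \sum_(i < n) t i * f' (x i) y)) ->
  same_fdd P Y Y'.
Proof.
move=> mY mY' fY fY' ff' n x B mB.
have mT (V : 'I_n -> Omega -> R) : (forall i, measurable_fun setT (V i)) ->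
    measurable_fun setT (fun w => [tuple V i w | i < n]).
  move=> mV; apply/measurable_fun_tnthP => i.
  by apply: (eq_measurable_fun (V i)) => // w _ /=; rewrite tnth_mktuple.
pose pack V (mV : measurable_fun setT (fun w => [tuple V i w | i < n])) :
  {mfun Omega >-> n.-tuple R} := HB.pack (fun w => [tuple V i w | i < n])
    (isMeasurableFun.Build _ _ _ _ _ mV).
have meanE (V : 'I_n -> Omega -> R) (mV : forall i,
    measurable_fun setT (V i)) (t : 'I_n -> R) (b : R) :
    \int[distribution P (pack V (mT V mV))]_x cos (dotp t x + b) =
    \int[P]_w cos (b + \sum_(i < n) t i * V i w).
  have bc := bounded_measurable_cos_dotp (R := R) t b.
  rewrite {1}/Rintegral integral_distribution/=; last 2 first.
  - by apply/measurable_EFinP; case: bc.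
  - apply: bounded_measurable_integrable.
    split; first by apply: (measurableT_comp bc.1); exact: mT.
    by have [K HK] := bc.2; exists K => w; exact: HK.
  apply: eq_Rintegral => w _ /=; rewrite addrC; congr (cos (_ + _)).
  by apply: eq_bigr => i _; rewrite tnth_mktuple.
have := @fourier_unique R n (distribution P (pack _ (mT _ (fun i => mY (x i)))))
  (distribution P (pack _ (mT _ (fun i => mY' (x i))))) _ B mB.
apply=> t b; rewrite !meanE.
rewrite (stable_integral_mean_cos b _ (stable_integral_sum _ t (fun i =>
  mY (x i))
  (fun i => fY (x i)))); last first.
  by apply: measurable_sum => i; exact: measurable_funM.
rewrite (stable_integral_mean_cos b _ (stable_integral_sum _ t (fun i =>
  mY' (x i))
  (fun i => fY' (x i)))); last first.
  by apply: measurable_sum => i; exact: measurable_funM.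
by rewrite ff'.
Qed.

End stable_integral.

(** * Lebesgue measure under translations and linear maps *)
Section affine_line.
Context {R : realType}.
Local Notation leb := (@lebesgue_measure R).

Definition affine (a t : R) : measurableTypeR R -> measurableTypeR R :=
  fun r => a * r + t.

Lemma measurable_affine (a t : R) : measurable_fun setT (affine a t).
Proof. by apply: measurable_funD => //; exact: measurable_funM. Qed.

Lemma affine_preimage_itv (a t x y : R) : 0 < a ->
  affine a t @^-1` `]x, y] = `](x - t) / a, (y - t) / a]%classic.
Proof.
move=> a0; apply/seteqP; split => r; rewrite /= /affine !in_itv/=;
  by rewrite ltr_pdivrMr// ler_pdivlMr// ltrBlDr lerBrDr [r * a]mulrC.
Qed.

(** Both sides are measures, so it is enough to compare them on intervals. *)
Lemma lebesgue_measure_affine_pos (a t : R) (A : set R) : 0 < a ->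
    measurable A ->
  leb A = (a%:E * leb (affine a t @^-1` A))%E.
Proof.
move=> a0 mA.
have a0' : 0 <= a by exact: ltW.
have := lebesgue_measure_unique
  (mu := mscale (NngNum a0') (pushforward leb (affine a t))).
move=> /(_ (measurable_affine a t)) H; rewrite H// => _ [[x y]] _ <-.
transitivity (a%:E * leb (affine a t @^-1` `]x, y]))%E; last by [].
rewrite affine_preimage_itv// !lebesgue_measure_itv/=.
rewrite !lte_fin ltr_pM2r ?invr_gt0// ltrD2r; case: ifP => _;
  last by rewrite mule0.
by rewrite -!EFinD -EFinM; congr EFin; field; rewrite gt_eqF.
Qed.

(** A negative [a] is reduced to a positive one by the reflection of the line. *)
Lemma ge0_integral_affine (a t : R) (F : R -> \bar R) : a != 0 ->
  measurable_fun setT F -> (forall r, 0 <= F r)%E ->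
  (\int[leb]_r F (a * r + t)%R = (`|a|^-1)%:E * \int[leb]_r F r)%E.
Proof.
wlog a0 : a t F / 0 < a => [wlg a_neq0 mF F0|_ mF F0].
  have [a0|a0|a0] := ltgtP a 0; last by rewrite a0 eqxx in a_neq0.
    pose G r := F (- r).
    have mG : measurable_fun setT G by exact: measurableT_comp.
    have Na0 : 0 < - a by rewrite oppr_gt0.
    transitivity (\int[leb]_r G (- a * r + (- t))%R)%E.
      by apply: eq_integral => r _; rewrite /G mulNr -opprD opprK.
    have Na : - a != 0 by rewrite gt_eqF.
    rewrite (wlg (- a) (- t) G Na0 Na mG (fun r => F0 (- r))).
    rewrite normrN; congr (_ * _)%E.
    transitivity (\int[pushforward leb (-%R : measurableTypeR R ->
      measurableTypeR R)]_r F r)%E.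
      by rewrite ge0_integral_pushforward// preimage_setT.
    by apply: eq_measure_integral => A mA _; exact: lebesgue_measureN.
  by apply: wlg.
have a0' : 0 <= a by exact: ltW.
transitivity (\int[pushforward leb (affine a t)]_r F r)%E.
  have := ge0_integral_pushforward (measurable_affine a t) leb measurableT mF
    (fun r _ => F0 r).
  by rewrite preimage_setT.
have lebE A : measurable A -> A `<=` setT ->
    leb A = mscale (NngNum a0') (pushforward leb (affine a t)) A.
  by move=> mA _; exact: lebesgue_measure_affine_pos.
rewrite [in RHS](eq_measure_integral _ (lebE (measurable_affine a t))).
have := ge0_integral_mscale (pushforward leb (affine a t)) measurableT (NngNum
    a0') mF
  (fun x _ => F0 x).
move=> /(_ (measurable_affine a t)) ->.
by rewrite /= muleA -EFinM gtr0_norm// mulVf ?gt_eqF// mul1e.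
Qed.

End affine_line.

Section linear_change_of_variables.
Context {R : realType}.
Local Notation leb := (@lebesgue_measure R).
Local Notation lam n := (lebesgue_cV (R := R) n).
Implicit Types (n : nat).

Lemma measurable_mulmx n m (M : 'M[R]_(m, n)) :
  measurable_fun setT (fun x : 'cV[R]_n => M *m x).
Proof.
apply: measurable_fun_cVP => i; under eq_fun do rewrite mxE.
by apply: measurable_sum => j; apply: measurable_funM => //;
  exact: measurable_coord.
Qed.

Lemma measurable_addmx n (h : 'cV[R]_n) : measurable_fun setT (fun x : 'cV[R]_n
    => x + h).
Proof.
apply: measurable_fun_cVP => i; under eq_fun do rewrite mxE.
by apply: measurable_funD => //; exact: measurable_coord.
Qed.

Section cons_integral.
Variables (n : nat) (F : 'cV[R]_n.+1 -> \bar R).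
Hypotheses (mF : measurable_fun setT F) (F0 : forall x, (0 <= F x)%E).

Let mFc : measurable_fun setT (fun p : measurableTypeR R * 'cV[R]_n =>
  F (cons_cV p)).
Proof. by apply: measurableT_comp => //; exact: measurable_cons_cV. Qed.

Lemma measurable_cons_section1 (r : R) :
  measurable_fun setT (fun x : 'cV[R]_n => F (cons_cV (r, x))).
Proof. exact: (measurableT_comp mFc (pair1_measurable r)). Qed.

Lemma measurable_cons_section2 (x : 'cV[R]_n) :
  measurable_fun setT (fun r : R => F (cons_cV (r, x))).
Proof. exact: (measurableT_comp mFc (pair2_measurable x)). Qed.

Lemma measurable_cons_integral :
  measurable_fun setT (fun x : 'cV[R]_n => \int[leb]_r F (cons_cV (r, x)))%E.
Proof. exact: (measurable_fun_fubini_tonelli_G (m1 := leb)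
  (fun p : measurableTypeR R * 'cV[R]_n => F (cons_cV p)) mFc (fun p =>
    F0 _)). Qed.

Lemma measurable_cons_integral1 :
  measurable_fun setT (fun r : R => \int[lam n]_x F (cons_cV (r, x)))%E.
Proof.
exact: (measurable_fun_fubini_tonelli_F (m2 := lam n)
  (fun p : measurableTypeR R * 'cV[R]_n => F (cons_cV p)) mFc (fun p => F0 _)).
Qed.

Lemma lebesgue_cV_integral_cons :
  (\int[lam n.+1]_x F x = \int[leb]_r \int[lam n]_x F (cons_cV (r, x)))%E.
Proof.
transitivity (\int[(leb \x lam n)%E]_p F (cons_cV p))%E.
  transitivity (\int[pushforward (leb \x lam n)%E (@cons_cV R n)]_x F x)%E;
    first by [].
  have := @ge0_integral_pushforward _ _ (measurableTypeR R * 'cV[R]_n)%type _ R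
      _
    (@measurable_cons_cV R n) (leb \x lam n)%E setT F measurableT mF (fun x _
      => F0 x).
  by rewrite preimage_setT.
by rewrite fubini_tonelli1//.
Qed.

Lemma lebesgue_cV_integral_cons2 :
  (\int[lam n.+1]_x F x = \int[lam n]_x \int[leb]_r F (cons_cV (r, x)))%E.
Proof.
rewrite lebesgue_cV_integral_cons.
exact: (fubini_tonelli (fun p : measurableTypeR R * 'cV[R]_n =>
  F (cons_cV p)) mFc (fun p => F0 _)).
Qed.

End cons_integral.

Lemma cons_cVD n (p q : R * 'cV[R]_n) :
  cons_cV p + cons_cV q = cons_cV (p.1 + q.1, p.2 + q.2).
Proof.
apply/colP => i; rewrite mxE; case: (unliftP ord0 i) => [j ->|->].
  by rewrite !cons_cVS mxE.
by rewrite !cons_cV0.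
Qed.

(** Tonelli: translate the last coordinates by induction, then the first one. *)
Lemma ge0_integral_cV_translation n (h : 'cV[R]_n) (F : 'cV[R]_n -> \bar R) :
  measurable_fun setT F -> (forall x, 0 <= F x)%E ->
  (\int[lam n]_x F (x + h)%R = \int[lam n]_x F x)%E.
Proof.
elim: n h F => [|n IH] h F mF F0.
  by apply: eq_integral => x _; congr F; apply/colP => -[].
have mFh : measurable_fun setT (fun x : 'cV[R]_n.+1 => F (x + h)).
  by apply: measurableT_comp => //; exact: measurable_addmx.
rewrite (lebesgue_cV_integral_cons mFh (fun x => F0 _)).
rewrite (lebesgue_cV_integral_cons mF F0).
rewrite -{1}(uncons_cVK h); case: (uncons_cV h) => s k.
transitivity (\int[leb]_r \int[lam n]_x F (cons_cV (r + s, x))%R)%E.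
  apply: eq_integral => r _.
  rewrite -(IH k _ (measurable_cons_section1 mF (r + s)))//.
  by apply: eq_integral => x _; rewrite cons_cVD.
have G0 (r : R) : (0 <= \int[lam n]_x F (cons_cV (r, x)))%E
    by exact: integral_ge0.
have := ge0_integral_affine s (@oner_neq0 R) (measurable_cons_integral1 mF F0)
    G0.
rewrite normr1 invr1 mul1e => <-.
by apply: eq_integral => r _; rewrite mul1r.
Qed.

(** Stated for integrals of nonnegative functions rather than for measures of
    sets, so that it composes and can be applied inside an iterated integral. *)
Definition substitution_rule n (M : 'M[R]_n) := forall F : 'cV[R]_n -> \bar R,
  measurable_fun setT F -> (forall x, 0 <= F x)%E ->
  (\int[lam n]_x F (M *m x) = (`|\det M|^-1)%:E * \int[lam n]_x F x)%E.

Lemma substitution_ruleM n (M N : 'M[R]_n) :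
  substitution_rule M -> substitution_rule N -> substitution_rule (M *m N).
Proof.
move=> HM HN F mF F0.
transitivity (\int[lam n]_x F (M *m (N *m x)))%E.
  by apply: eq_integral => x _; rewrite mulmxA.
rewrite (HN (fun x => F (M *m x)))//; last first.
  by apply: measurableT_comp => //; exact: measurable_mulmx.
by rewrite HM// muleA -EFinM det_mulmx normrM invfM mulrC.
Qed.

Lemma mul_block_cons n (a : R) (w : 'rV[R]_n) (v : 'cV[R]_n) (D : 'M[R]_n)
    (r : R) (x : 'cV[R]_n) :
  (block_mx a%:M w v D : 'M[R]_n.+1) *m cons_cV (r, x) =
  cons_cV (a * r + (w *m x) ord0 ord0, r *: v + D *m x).
Proof.
transitivity (block_mx a%:M w v D *m col_mx (r%:M : 'M[R]_1) x); first by [].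
rewrite mul_block_col !mul_mx_scalar scale_scalar_mx mulrC.
by rewrite [in LHS](mx11_scalar (w *m x)) -raddfD.
Qed.

(** Integrate the first coordinate first: for fixed [x] it undergoes an affine
    map of the line, and [x] itself is mapped by [D]. *)
Lemma substitution_rule_upper n (a : R) (w : 'rV[R]_n) (D : 'M[R]_n) :
  a != 0 -> substitution_rule D ->
  substitution_rule (block_mx a%:M w 0 D : 'M[R]_n.+1).
Proof.
move=> a0 HD F mF F0; set M := block_mx a%:M w 0 D.
have mFM : measurable_fun setT (fun x : 'cV[R]_n.+1 => F (M *m x)).
  by apply: measurableT_comp => //; exact: measurable_mulmx.
rewrite (lebesgue_cV_integral_cons2 mFM)// (lebesgue_cV_integral_cons2 mF)//.
have -> : \det M = a * \det D by rewrite [LHS]det_ublock det_scalar expr1.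
transitivity (\int[lam n]_x ((`|a|^-1)%:E * \int[leb]_r F (cons_cV (r,
  D *m x))))%E.
  apply: eq_integral => x _.
  rewrite -(ge0_integral_affine ((w *m x) ord0 ord0) a0
    (measurable_cons_section2 mF (D *m x)) (fun r => F0 _)).
  by apply: eq_integral => r _; rewrite mul_block_cons scaler0 add0r.
have mG := measurable_cons_integral mF F0.
have G0 x : (0 <= \int[leb]_r F (cons_cV (r, x)))%E by exact: integral_ge0.
have mGD : measurable_fun setT
    (fun x : 'cV[R]_n => \int[leb]_r F (cons_cV (r, D *m x)))%E.
  exact: (measurableT_comp mG (measurable_mulmx D)).
have a'0 : (0 <= (`|a|^-1)%:E)%E by rewrite lee_fin invr_ge0.
rewrite (ge0_integralZl (lam n) measurableT mGD (fun x _ => G0 (D *m x)) a'0).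
by rewrite (HD _ mG G0) muleA -EFinM normrM invfM.
Qed.

(** Integrate the last coordinates first: for fixed [r] they are translated by
    [r v]. *)
Lemma substitution_rule_lower n (v : 'cV[R]_n) :
  substitution_rule (block_mx 1%:M 0 v 1%:M : 'M[R]_n.+1).
Proof.
move=> F mF F0; set M := block_mx 1%:M 0 v 1%:M.
have mFM : measurable_fun setT (fun x : 'cV[R]_n.+1 => F (M *m x)).
  by apply: measurableT_comp => //; exact: measurable_mulmx.
rewrite (lebesgue_cV_integral_cons mFM)// (lebesgue_cV_integral_cons mF)//.
have -> : \det M = 1 by rewrite [LHS]det_lblock !det_scalar !expr1n mulr1.
rewrite normr1 invr1 mul1e; apply: eq_integral => r _.
rewrite -(ge0_integral_cV_translation (r *: v) (measurable_cons_section1 mF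
  r))//.
apply: eq_integral => x _; rewrite mul_block_cons mul0mx mul1mx mxE addr0 mul1r.
by rewrite addrC.
Qed.

(** By induction on the dimension. If the corner of [M] is nonzero, [M] is a lower
    shear times a block upper triangular matrix whose lower block is the Schur
    complement. Otherwise a row with nonzero first entry is added to the first
    row, by an upper shear [S 1] with inverse [S (-1)]. *)
Lemma substitution_rule_unit n (M : 'M[R]_n) : \det M != 0 ->
    substitution_rule M.
Proof.
elim: n M => [|n IH] M dM.
  move=> F mF F0; rewrite det_mx00 normr1 invr1 mul1e.
  by apply: eq_integral => x _; congr F; apply/colP => -[].
have H1 : substitution_rule (1%:M : 'M[R]_n).
  move=> F mF F0; rewrite det1 normr1 invr1 mul1e.
  by apply: eq_integral => x _; rewrite mul1mx.
have pivot (N : 'M[R]_n.+1) : \det N != 0 -> N ord0 ord0 != 0 ->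
    substitution_rule N.
  move=> dN N0; pose N' : 'M[R]_(1 + n) := N.
  have a0 : ulsubmx N' ord0 ord0 != 0.
    rewrite mxE mxE; apply: contraNneq N0 => <-.
    by apply/eqP; congr (N _ _); exact/val_inj.
  set a := ulsubmx N' ord0 ord0 in a0.
  pose v := a^-1 *: dlsubmx N'.
  pose D := drsubmx N' - v *m ursubmx N'.
  have NE : N' = block_mx 1%:M 0 v 1%:M *m block_mx a%:M (ursubmx N') 0 D.
    rewrite mulmx_block !mul1mx !mul0mx !addr0.
    rewrite -[LHS]submxK; congr block_mx.
    - exact: mx11_scalar.
    - by rewrite mul_mx_scalar scalerA mulfV// scale1r.
    - by rewrite /D addrC subrK.
  change (@substitution_rule n.+1 N'); rewrite NE.
  apply: substitution_ruleM; first exact: substitution_rule_lower.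
  apply: substitution_rule_upper => //; apply: IH.
  have : \det N' != 0 by [].
  by rewrite NE det_mulmx det_ublock !mulf_eq0 !negb_or => /andP[_ /andP[]].
have [M0|M0] := eqVneq (M ord0 ord0) 0; last exact: pivot.
pose M' : 'M[R]_(1 + n) := M.
have [v0|v0] := eqVneq (dlsubmx M') 0.
  exfalso; move/eqP : dM; apply.
  have a0 : ulsubmx M' = 0.
    rewrite [LHS]mx11_scalar mxE mxE.
    rewrite (_ : M' _ _ = 0) ?raddf0// -M0; congr (M _ _); exact/val_inj.
  change (\det M' = 0).
  by rewrite -[M']submxK v0 a0 det_ublock det_mx11 mxE mul0r.
have [i vi] : exists i, dlsubmx M' i ord0 != 0.
  apply/existsP; apply: contraNT v0 => /existsPn vi.
  by apply/eqP/colP => i; rewrite [RHS]mxE; apply/eqP;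
    rewrite -[_ == _]negbK vi.
pose S (s : R) : 'M[R]_(1 + n) := block_mx 1%:M (s *: delta_mx 0 i) 0 1%:M.
have SS : S (-1) *m S 1 = 1%:M.
  rewrite /S mulmx_block !mul1mx !mulmx1 !mulmx0 !mul0mx !addr0 !add0r.
  by rewrite scaleN1r scale1r subrr -scalar_mx_block.
have HS s : substitution_rule (S s) by apply: substitution_rule_upper => //;
    exact: oner_neq0.
have ME : M' = S (-1) *m (S 1 *m M') by rewrite mulmxA SS mul1mx.
change (@substitution_rule n.+1 M'); rewrite ME.
apply: substitution_ruleM => //; apply: pivot.
  have dS : \det (S 1) = 1 by rewrite /S det_ublock !det1 mulr1.
  change (\det (S 1 *m M') != 0).
  by rewrite det_mulmx dS mul1r.
have ul0 : ulsubmx M' ord0 ord0 = 0.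
  by rewrite mxE mxE -M0; congr (M _ _); exact/val_inj.
have SME : (S 1 *m M') (lshift n ord0) (lshift n ord0) = dlsubmx M' i ord0.
  rewrite -[in LHS](submxK M') /S mulmx_block block_mxEul mul1mx scale1r.
  by rewrite [LHS]mxE ul0 add0r -rowE [LHS]mxE.
rewrite (_ : ord0 = lshift n ord0 :> 'I_(1 + n)); last exact/val_inj.
by rewrite -SME in vi.
Qed.

End linear_change_of_variables.

(** * The determinant of a matrix exponential *)
Section exponential_determinant.
Context {R : realType}.

(** [1 + x] lies between [exp (x / (1 + x))] and [exp x]. *)
Lemma cvg_compound_expR (x : nat -> R) (k : R) :
  n.+1%:R * x n @[n --> \oo] --> k ->
  (1 + x n) ^+ n.+1 @[n --> \oo] --> expR k.
Proof.
move=> nx.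
have x0 : x n @[n --> \oo] --> 0.
  have xE : x = (fun n => n.+1%:R^-1 * (n.+1%:R * x n)).
    by apply/funext => n; rewrite mulKf.
  by rewrite xE -(mul0r k); apply: cvgM => //; exact: cvg_harmonic.
have up : expR (n.+1%:R * x n) @[n --> \oo] --> expR k.
  by apply: continuous_cvg => //; exact: continuous_expR.
have lo : expR (n.+1%:R * x n / (1 + x n)) @[n --> \oo] --> expR k.
  apply: continuous_cvg; first exact: continuous_expR.
  rewrite -[X in _ --> X]divr1; apply: cvgM => //; apply: cvgV => //.
  by rewrite -[X in _ --> X]addr0; apply: cvgD => //; exact: cvg_cst.
apply: (squeeze_cvgr _ lo up).
have x1 : \forall n \near \oo, -1 < x n by apply: (cvgr_gt 0 x0); lra.
near=> n.
have xn : 0 < 1 + x n.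
  by have : -1 < x n by [near: n|]; lra.
have H1 : 1 + x n <= expR (x n) by exact: expR_ge1Dx.
have H2 : expR (x n / (1 + x n)) <= 1 + x n.
  rewrite -[leRHS]invrK -[leLHS]invrK lef_pV2 ?posrE ?invr_gt0 ?expR_gt0//.
  rewrite -expRN; apply: le_trans (expR_ge1Dx _).
  by rewrite le_eqVlt; apply/orP; left; apply/eqP; field; rewrite gt_eqF.
apply/andP; split.
  rewrite -mulrA mulrC expRM_natr lerXn2r ?nnegrE ?expR_ge0//.
  exact: ltW.
by rewrite [n.+1%:R * _]mulrC expRM_natr lerXn2r ?nnegrE ?expR_ge0// ltW.
Unshelve. all: by end_near.
Qed.

Lemma cvg_sumr (I : Type) (s : seq I) (u : nat -> I -> R) (l : I -> R) :
  (forall i, u n i @[n --> \oo] --> l i) ->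
  \sum_(i <- s) u n i @[n --> \oo] --> \sum_(i <- s) l i.
Proof.
move=> ul; elim: s => [|i s IH].
  by rewrite big_nil; under eq_fun do rewrite big_nil; exact: cvg_cst.
by rewrite big_cons; under eq_fun do rewrite big_cons; exact: cvgD.
Qed.

Lemma cvg_prodr (I : Type) (s : seq I) (u : nat -> I -> R) (l : I -> R) :
  (forall i, u n i @[n --> \oo] --> l i) ->
  \prod_(i <- s) u n i @[n --> \oo] --> \prod_(i <- s) l i.
Proof.
move=> ul; elim: s => [|i s IH].
  by rewrite big_nil; under eq_fun do rewrite big_nil; exact: cvg_cst.
by rewrite big_cons; under eq_fun do rewrite big_cons; exact: cvgM.
Qed.

Context {d : nat}.
Implicit Types (A : 'M[R]_d).

Lemma cvg_det (B : nat -> 'M[R]_d) (L : 'M[R]_d) :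
  (forall i j, B n i j @[n --> \oo] --> L i j) ->
  \det (B n) @[n --> \oo] --> \det L.
Proof.
move=> BL; apply: cvg_sumr => s; apply: cvgM; first exact: cvg_cst.
by apply: cvg_prodr => i.
Qed.

Lemma det_expr A k : \det (A ^+ k) = \det A ^+ k.
Proof.
elim: k => [|k IH]; first by rewrite !expr0 det1.
by rewrite !exprS -IH -det_mulmx.
Qed.

Lemma scalemx_expr (c : R) A k : (c *: A) ^+ k = c ^+ k *: A ^+ k.
Proof.
elim: k => [|k IH]; first by rewrite !expr0 scale1r.
rewrite !exprS IH; transitivity ((c *: A) *m (c ^+ k *: A ^+ k)) => //.
by rewrite -scalemxAl -scalemxAr scalerA.
Qed.

(** [det (1 + A/N)] is [N^-d] times the characteristic polynomial of [- A] at [N],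
    whose two leading terms are [N^d] and [tr A N^(d-1)]. *)
Lemma cvg_det_1D A : (0 < d)%N ->
  n.+1%:R * (\det (1%:M + n.+1%:R^-1 *: A) - 1) @[n --> \oo] --> \tr A.
Proof.
case: d A => [//|e] A _ /=.
pose p := char_poly (- A).
have detE (x : R) : x != 0 -> \det (1%:M + x^-1 *: A) = x ^- e.+1 * p.[x].
  move=> x0; have -> : p.[x] = \det (x%:M + A).
    rewrite /p /char_poly -horner_evalE -det_map_mx; congr (\det _).
    apply/matrixP => i j; rewrite !mxE /= horner_evalE.
    by rewrite hornerD hornerN hornerC opprK hornerMn hornerX.
  have -> : 1%:M + x^-1 *: A = x^-1 *: (x%:M + A).
    by rewrite scalerDr scale_scalar_mx mulVf.
  by rewrite detZ exprVn.
have pE (x : R) : p.[x] = \sum_(k < e) p`_k * x ^+ k + \tr A * x ^+ e + x ^+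
    e.+1.
  rewrite horner_coef size_char_poly !big_ord_recr/=; congr (_ + _ * _ + _).
    by have := @char_poly_trace _ _ (- A) isT; rewrite raddfN opprK.
  have /monicP := char_poly_monic (- A).
  by rewrite lead_coefE size_char_poly/= => ->; rewrite mul1r.
have NE n : n.+1%:R * (\det (1%:M + n.+1%:R^-1 *: A) - 1) =
    \sum_(k < e) p`_k * n.+1%:R^-1 ^+ (e - k) + \tr A.
  have n0 : n.+1%:R != 0 :> R by rewrite pnatr_eq0.
  rewrite detE// pE exprS; set S := \sum_(k < e) _.
  have -> : \sum_(k < e) p`_k * n.+1%:R^-1 ^+ (e - k) = S / n.+1%:R ^+ e.
    rewrite mulr_suml; apply: eq_bigr => k _; rewrite -mulrA; congr (_ * _).
    have -> : n.+1%:R ^+ e = n.+1%:R ^+ (e - k) * n.+1%:R ^+ k :> R.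
      by rewrite -exprD subnK// ltnW.
    by rewrite invfM mulrCA mulfV ?expf_neq0// mulr1 exprVn.
  have : n.+1%:R ^+ e != 0 :> R by rewrite expf_neq0.
  move: (_ ^+ e) => y y0; clearbody S; move: n.+1%:R n0 => x x0.
  by field; rewrite y0 x0.
suff lim : (\sum_(k < e) p`_k * n.+1%:R^-1 ^+ (e - k)) + \tr A @[n --> \oo] -->
    (\sum_(k < e) 0) + \tr A.
  by rewrite big1// add0r in lim; under eq_fun do rewrite NE.
apply: cvgD; last exact: cvg_cst.
apply: (@cvg_sumr _ _ (fun n (k : 'I_e) => p`_k * n.+1%:R^-1 ^+ (e - k)) (fun=>
  0)) => k.
rewrite -[X in _ --> X](mulr0 p`_k); apply: cvgM; first exact: cvg_cst.
have -> : 0 = 0 ^+ (e - k) :> R by rewrite expr0n subn_eq0 leqNgt ltn_ord.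
apply: (continuous_cvg _ (@exprn_continuous R (e - k) 0)).
exact: cvg_harmonic.
Qed.

(** A crude norm, large enough that every entry of [A ^+ k] is bounded by
    [mxabs A ^+ k]. *)
Definition mxabs A : R := \sum_i \sum_j `|A i j|.

Lemma mxabs_ge0 A : 0 <= mxabs A.
Proof. by apply: sumr_ge0 => i _; apply: sumr_ge0. Qed.

Lemma norm_expr_entry A k i j : `|(A ^+ k) i j| <= mxabs A ^+ k.
Proof.
elim: k i j => [|k IH] i j.
  by rewrite !expr0 mxE; case: (i == j); rewrite ?normr1 ?normr0.
rewrite !exprSr mxE; apply: (le_trans (ler_norm_sum _ _ _)).
apply: (@le_trans _ _ (\sum_l mxabs A ^+ k * `|A l j|)).
  by apply: ler_sum => l _; rewrite normrM ler_wpM2r.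
rewrite -mulr_sumr ler_wpM2l ?exprn_ge0 ?mxabs_ge0//.
apply: ler_sum => l _; rewrite (bigD1 j)//= lerDl.
by apply: sumr_ge0.
Qed.

(** The series defining [expmx A] is dominated, entry by entry, by the exponential
    series of [mxabs A]. *)
Lemma expmx_entry A i j :
  series (fun k => k`!%:R^-1 * (A ^+ k) i j) @ \oo --> expmx A i j.
Proof.
pose u := series (fun k => k`!%:R^-1 *: A ^+ k).
have uE i' j' n : u n i' j' = series (fun k => k`!%:R^-1 * (A ^+ k) i' j') n.
  by rewrite /u /series/= summxE; apply: eq_bigr => k _; rewrite mxE.
have ucvg i' j' : cvgn (series (fun k => k`!%:R^-1 * (A ^+ k) i' j')).
  apply: normed_cvg; apply: series_le_cvg (@is_cvg_series_exp_coeff R (mxabs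
    A)).
  - by move=> k; rewrite normr_ge0.
  - by move=> k; rewrite /exp_coeff/= divr_ge0 ?exprn_ge0 ?mxabs_ge0.
  - move=> k; rewrite /exp_coeff/= normrM ger0_norm ?invr_ge0// mulrC.
    by rewrite ler_wpM2r ?invr_ge0// norm_expr_entry.
pose L := \matrix_(i', j') limn (series (fun k => k`!%:R^-1 * (A ^+ k) i' j')).
have uL : u @ \oo --> L.
  apply/cvg_ballP => e e0.
  have H i' j' : \forall n \near \oo, ball (L i' j') e (u n i' j').
    have /cvg_ballP/(_ _ e0) := ucvg i' j'.
    by apply: filterS => n; rewrite uE mxE.
  have {}H : \forall n \near \oo, forall i' j', ball (L i' j') e (u n i' j').
    by apply: filter_forall => i'; apply: filter_forall => j'; exact: H.
  by apply: filterS H => n Hn; split.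
have ucv : cvgn u by apply/cvg_ex; exists L.
rewrite (_ : series _ = fun n => u n i j); last by apply/funext => n;
  rewrite uE.
exact: (continuous_cvg _ (@coord_continuous R d d i j (limn u)) ucv).
Qed.

Lemma ffact_le_expn n k : (n ^_ k <= n ^ k)%N.
Proof.
elim: k n => [|k IH] [|n] //; rewrite ffactSS expnS leq_mul//.
by apply: (leq_trans (IH n)); case: k {IH} => // k; rewrite leq_exp2r.
Qed.

Lemma binomial_coeff_le (n k : nat) :
  'C(n.+1, k)%:R * n.+1%:R^-1 ^+ k <= k`!%:R^-1 :> R.
Proof.
rewrite -[leRHS]mul1r ler_pdivlMr ?ltr0n ?fact_gt0// mulrAC -natrM bin_ffact.
by rewrite exprVn -natrX ler_pdivrMr ?ltr0n ?expn_gt0// mul1r ler_nat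
  ffact_le_expn.
Qed.

(** The coefficients ['C(N, k) / N^k] of [(1 + A/N)^N] are at most [1/k!]. Hence
    its distance to the partial sum of the exponential series is, entry by
    entry, at most the same distance for the number [mxabs A], which tends
    to 0. *)
Lemma cvg_compound_expmx A i j :
  ((1%:M + n.+1%:R^-1 *: A) ^+ n.+1) i j @[n --> \oo] --> expmx A i j.
Proof.
pose a := mxabs A.
pose S n := series (fun k => k`!%:R^-1 * (A ^+ k) i j) n.+2.
pose s n := series (exp_coeff a) n.+2.
pose c n k : R := 'C(n.+1, k)%:R * n.+1%:R^-1 ^+ k.
have c0 n k : 0 <= c n k by rewrite mulr_ge0 ?exprn_ge0.
have SE : S @ \oo --> expmx A i j.
  have := @expmx_entry A i j; rewrite -(cvg_shiftn 2) /=.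
  by under eq_fun do rewrite addn2.
have sE : s @ \oo --> expR a.
  have : series (exp_coeff a) @ \oo --> expR a
      by exact: is_cvg_series_exp_coeff.
  by rewrite -(cvg_shiftn 2) /=; under eq_fun do rewrite addn2.
have bE : (1 + a / n.+1%:R) ^+ n.+1 @[n --> \oo] --> expR a.
  apply: cvg_compound_expR.
  by under eq_fun do rewrite mulrC divfK//; exact: cvg_cst.
have dE : s n - (1 + a / n.+1%:R) ^+ n.+1 @[n --> \oo] --> (0 : R).
  by rewrite -(subrr (expR a)); exact: cvgB.
have BE n : ((1%:M + n.+1%:R^-1 *: A) ^+ n.+1) i j =
    \sum_(0 <= k < n.+2) c n k * (A ^+ k) i j.
  rewrite exprDn_comm; last by rewrite /GRing.comm mul1r mulr1.
  rewrite summxE big_mkord; apply: eq_bigr => k _.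
  by rewrite expr1n mul1r scalemx_expr mulmxnE mxE -[LHS]mulr_natl mulrA.
have SB n : `|S n - ((1%:M + n.+1%:R^-1 *: A) ^+ n.+1) i j| <=
    s n - (1 + a / n.+1%:R) ^+ n.+1.
  have -> : (1 + a / n.+1%:R) ^+ n.+1 = \sum_(0 <= k < n.+2) c n k * a ^+ k.
    rewrite exprDn big_mkord; apply: eq_bigr => k _.
    by rewrite /c expr1n mul1r exprMn -[LHS]mulr_natl; ring.
  rewrite BE /S /s /series/= -!sumrB; apply: (le_trans (ler_norm_sum _ _ _)).
  apply: ler_sum => k _; rewrite -mulrBl normrM /exp_coeff/= [a ^+ k
    / _]mulrC -mulrBl.
  have ck : 0 <= k`!%:R^-1 - c n k by rewrite subr_ge0 binomial_coeff_le.
  by rewrite ger0_norm// ler_wpM2l// norm_expr_entry.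
have lim0 : S n - ((1%:M + n.+1%:R^-1 *: A) ^+ n.+1) i j @[n --> \oo] --> (0 :
    R).
  apply/norm_cvg0P; apply: (squeeze_cvgr _ (cvg_cst 0) dE).
  by apply: nearW => n; rewrite normr_ge0/= SB.
have : S n - (S n - ((1%:M + n.+1%:R^-1 *: A) ^+ n.+1) i j) @[n --> \oo] -->
    expmx A i j - 0 by exact: cvgB.
by rewrite subr0; under eq_fun do rewrite opprB addrC subrK.
Qed.

Lemma det_expmx A : (0 < d)%N -> \det (expmx A) = expR (\tr A).
Proof.
move=> d0; have lim := cvg_det (@cvg_compound_expmx A).
have lim' := cvg_compound_expR (@cvg_det_1D A d0).
move: lim'; under eq_fun do rewrite [1 + _]addrC subrK; move=> lim'.
move: lim; under eq_fun do rewrite det_expr; move=> lim.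
exact: cvg_unique lim lim'.
Qed.

Lemma det_powmx (c : R) A : (0 < d)%N -> 0 < c -> \det (powmx c A) = c `^ \tr A.
Proof.
by move=> d0 c0; rewrite det_expmx// mxtraceZ /powR gt_eqF// mulrC.
Qed.

End exponential_determinant.

(** * Scaling and translation of the moving-average kernel *)
Section null_points.
Context {R : realType} {d : nat}.

Lemma set1_cVE (x : 'cV[R]_d) :
  [set x] = [set y | forall i, [set x i ord0] (y i ord0)].
Proof. by apply/seteqP; split => y /= => [->//|yx]; apply/colP => i;
  exact: yx. Qed.

Lemma measurable_set1_cV (x : 'cV[R]_d) : measurable [set x].
Proof.
have -> : [set x] = \bigcap_(i in [set: 'I_d])
    ((fun y : 'cV[R]_d => y i ord0) @^-1` [set x i ord0]).
  by rewrite set1_cVE; apply/seteqP; split => [y /= H i _|y /= H i]; exact: H.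
apply: fin_bigcap_measurable => // i _.
by rewrite -[X in measurable X]setTI; exact: measurable_coord.
Qed.

Lemma lebesgue_cV_set1 (x : 'cV[R]_d) : (0 < d)%N ->
    lebesgue_cV d [set x] = 0%E.
Proof.
move=> d0; rewrite set1_cVE (lebesgue_cV_box (A := fun i => [set x i ord0]))//.
by rewrite (bigD1 (Ordinal d0))//= lebesgue_measure_set1 mul0e.
Qed.

Lemma ae_neq_point (x : 'cV[R]_d) : (0 < d)%N ->
  {ae (lebesgue_cV d), forall y, y != x}.
Proof.
move=> d0; exists [set x]; split.
- exact: measurable_set1_cV.
- exact: lebesgue_cV_set1.
- by move=> y /= /negP; rewrite negbK => /eqP.
Qed.

End null_points.

Section moving_average.
Context {R : realType} {d : nat}.
Variables (alpha H : R) (E : 'M[R]_d) (phi : 'cV[R]_d -> R).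
Hypotheses (d_gt0 : (0 < d)%N) (alpha_gt0 : 0 < alpha).
Hypothesis phi_ge0 : forall x, 0 <= phi x.
Hypothesis phi_hom : E_homogeneous E phi.
Let a := H - \tr E / alpha.
Local Notation ker := (moving_average_kernel a phi).
Local Notation lam := (lebesgue_cV d).

(** The two excluded points are those where [phi] is evaluated at 0, about which
    homogeneity says nothing. *)
Lemma kernel_scale (c : R) (x y : 'cV[R]_d) : 0 < c -> y != 0 -> y != x ->
  ker (powmx c E *m x) (powmx c E *m y) = c `^ a * ker x y.
Proof.
move=> c0 y0 yx; rewrite /moving_average_kernel -mulmxBr -mulmxN.
have xy0 : x - y != 0 by rewrite subr_eq0 eq_sym.
have Ny0 : - y != 0 by rewrite oppr_eq0.
rewrite (phi_hom c0 xy0) (phi_hom c0 Ny0).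
rewrite (powRM a (ltW c0) (phi_ge0 (x - y))) (powRM a (ltW c0) (phi_ge0 (- y))).
by rewrite -mulrBr.
Qed.

(** Substitute [y = c^E z]. The kernel contributes [c^(alpha (H - q/alpha))] and the
    Jacobian [c^q], with [q] the trace of [E]; finitely many points are
    negligible. *)
Lemma pint_kernel_scale (n : nat) (t : 'I_n -> R) (x : 'I_n ->
    'cV[R]_d) (c : R) :
  0 < c -> (forall y, measurable_fun setT (ker y)) ->
  pint lam alpha (fun y => \sum_(i < n) t i * ker (powmx c E *m x i) y) =
  pint lam alpha (fun y => \sum_(i < n) t i * (c `^ H * ker (x i) y)).
Proof.
move=> c0 mker; set M := powmx c E.
have dM : \det M = c `^ \tr E by exact: det_powmx.
have dM0 : 0 < \det M by rewrite dM powR_gt0.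
have msum (x' : 'I_n -> 'cV[R]_d) : measurable_fun setT (fun y =>
    \sum_(i < n) t i * ker (x' i) y).
  by apply: measurable_sum => i; exact: measurable_funM.
pose G y := \sum_(i < n) t i * ker (x i) y.
pose GM y := \sum_(i < n) t i * ker (M *m x i) y.
have pZ (b : R) : 0 <= b ->
    pint lam alpha (fun y => b * G y) = ((b `^ alpha)%:E * pint lam alpha G)%E.
  by move=> b0; rewrite (pintZ lam alpha b (msum x)) ger0_norm.
have HE : (fun y => \sum_(i < n) t i * (c `^ H * ker (x i) y)) = (fun y =>
    c `^ H * G y).
  by apply/funext => y; rewrite mulr_sumr; apply: eq_bigr => i _;
    rewrite mulrCA.
have aeE : (\int[lam]_y (`|GM (M *m y)| `^ alpha)%:E =
    pint lam alpha (fun y => (c `^ a * G y)%R))%E.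
  apply: ge0_ae_eq_integral => //.
  - apply/measurable_EFinP; apply: measurable_pint.
    exact: (measurableT_comp (msum _) (measurable_mulmx M)).
  - apply/measurable_EFinP; apply: measurable_pint;
    apply: measurable_funM => //.
    exact: msum.
  have ae_x := ae_all_seq (s := index_enum 'I_n) (fun i _ =>
      ae_neq_point (x i) d_gt0).
  apply: filterS2 (ae_neq_point 0 d_gt0) ae_x => y y0 yx _.
  congr (`|_| `^ _)%:E; rewrite mulr_sumr; apply: eq_bigr => i _.
  by rewrite kernel_scale// ?yx ?mem_index_enum// mulrCA.
have subst : (\int[lam]_y (`|GM (M *m y)| `^ alpha)%:E =
    (`|\det M|^-1)%:E * pint lam alpha GM)%E.
  apply: (substitution_rule_unit (lt0r_neq0 dM0)
    (F := fun y => (`|GM y| `^ alpha)%:E)) => [|y];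
      last by rewrite lee_fin powR_ge0.
  apply/measurable_EFinP; apply: measurable_pint; exact: msum.
have mulVe (p : \bar R) : p = ((\det M)%:E * ((`|\det M|^-1)%:E * p))%E.
  by rewrite muleA -EFinM gtr0_norm// mulfV ?gt_eqF// mul1e.
rewrite HE (pZ _ (powR_ge0 _ _)) [LHS]mulVe -subst aeE (pZ _ (powR_ge0 _ _)).
rewrite muleA -EFinM dM -!powRrM -powRD; last first.
  by apply/implyP => _; rewrite gt_eqF.
congr ((_ `^ _)%:E * _)%E; rewrite /a mulrBl divfK ?gt_eqF//; ring.
Qed.

(** The terms [phi (- y)] cancel in [f_{x+h} - f_h], and what remains is [f_x]
    translated by [h]. *)
Lemma pint_kernel_translation (n : nat) (t : 'I_n -> R) (x : 'I_n ->
    'cV[R]_d) (h : 'cV[R]_d) :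
  (forall y, measurable_fun setT (ker y)) ->
  pint lam alpha (fun y => \sum_(i < n) t i * (ker (x i + h) y - ker h y)) =
  pint lam alpha (fun y => \sum_(i < n) t i * ker (x i) y).
Proof.
move=> mker; rewrite -[RHS](ge0_integral_cV_translation (- h)); last 2 first.
- apply/measurable_EFinP; apply: measurable_pint.
  by apply: measurable_sum => i; exact: measurable_funM.
- by move=> y; rewrite lee_fin powR_ge0.
apply: eq_integral => y _; congr (`|_| `^ _)%:E; apply: eq_bigr => i _;
  congr (_ * _).
rewrite /moving_average_kernel opprB addrA [x i + h]addrC.
have -> : h + x i - y = x i + (h - y) by rewrite addrAC addrC addrA.
by rewrite opprB; ring.
Qed.

End moving_average.

Theorem corollary3p2 (R : realType) (d : nat) (hd : (0 < d)%N)
    (E : 'M[R]_d)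
    (hE : forall l : R[i],
      eigenvalue (map_mx (real_complex R) E) l -> 0 < complex.Re l)
    (norm0 : 'cV[R]_d -> R) (hnorm0 : adapted_norm E norm0)
    (beta : R) (hbeta : 0 < beta)
    (phi : 'cV[R]_d -> R)
    (hphi : E_homogeneous E phi) (hadm : admissible beta E norm0 phi)
    (alpha : R) (halpha0 : 0 < alpha) (halpha2 : alpha <= 2)
    (H : R) (hH0 : 0 < H) (hHbeta : H < beta)
    (dO : measure_display) (Omega : measurableType dO) (P : probability Omega R)
    (Z : set 'cV[R]_d -> {RV P >-> R}) (hZ : sas_random_measure alpha Z)
    (X : 'cV[R]_d -> {RV P >-> R})
    (hX : forall x : 'cV[R]_d, is_stable_integral alpha Z
      (moving_average_kernel (H - \tr E / alpha) phi x) (X x)) :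
  (forall c : R, 0 < c ->
    same_fdd P (fun (x : 'cV[R]_d) w => X (powmx c E *m x) w)
               (fun (x : 'cV[R]_d) w => c `^ H * X x w)) /\
  (forall h : 'cV[R]_d,
    same_fdd P (fun (x : 'cV[R]_d) w => X (x + h) w - X h w)
               (fun (x : 'cV[R]_d) w => X x w)).
Proof.
have [_ phi_ge0 _ _] := hadm.
pose f := moving_average_kernel (H - \tr E / alpha) phi.
have mf x : measurable_fun setT (f x) by case: (hX x).
have mX x : measurable_fun setT (X x) by [].
split=> [c c0|h].
- apply: (stable_integral_same_fdd halpha0 hZ
    (f := fun x => f (powmx c E *m x)) (f' := fun x y => c `^ H * f x y)).
  + by move=> x; exact: mX.
  + by move=> x; exact: measurable_funM.
  + by move=> x; exact: hX.
  + move=> x; have := stable_integral_linear halpha0 hZ (c `^ H) (mX x)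
      (measurable_cst _) (hX x) (stable_integral0 halpha0 Z).
    under eq_fun do rewrite addr0.
    by under [X in is_stable_integral _ _ _ X -> _]eq_fun do rewrite addr0.
  + by move=> n x s; exact: pint_kernel_scale.
- apply: (stable_integral_same_fdd halpha0 hZ
    (f := fun x y => f (x + h) y - f h y) (f' := f)).
  + by move=> x; exact: measurable_funB.
  + by move=> x; exact: mX.
  + move=> x; have := stable_integral_linear halpha0 hZ (-1) (mX h) (mX (x + h))
      (hX h) (hX (x + h)).
    under eq_fun do rewrite mulN1r addrC.
    by under [X in is_stable_integral _ _ _ X -> _]eq_fun
      do rewrite mulN1r addrC.
  + by move=> x; exact: hX.
  + by move=> n x s; apply: pint_kernel_translation.
Qed.
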